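(* Let $I$ be a proper nonzero monomial ideal of $S=\mathbb{K}[x_1,\ldots,x_n]$. Then for every pair of integers $s,m\geq 1$, we have $$\operatorname{reg}(\overline{I^{sm}})\geq \operatorname{reg}(\overline{I^s})+\gamma(I)s(m-1).$$
   Context: $\mathbb{K}$ is a field and $S=\mathbb{K}[x_1,\ldots,x_n]$ is the (standard graded) polynomial ring in $n$ variables. For a graded $S$-module $M$ with graded Betti numbers $\beta_{i,j}(M)$ (so the minimal graded free resolution of $M$ has $i$-th term $\bigoplus_j S(-j)^{\beta_{i,j}(M)}$), the Castelnuovo--Mumford regularity is $\operatorname{reg}(M)=\max\{j-i : \beta_{i,j}(M)\neq 0\}$; ideals are regarded as graded $S$-modules. For a monomial ideal $I$, $G(I)$ is its unique set of minimal monomial generators. For a monomial $u$, $\deg_{x_j}(u)$ is the exponent of $x_j$ in $u$, and $$\gamma(I):=\min\{\deg_{x_j}(u) : 1\leq j\leq n,\ u\in G(I),\ x_j \text{ divides } u\}.$$ For an ideal $J$ of $S$, $\overline{J}$ denotes its integral closure in $S$, i.e. the set of $f\in S$ satisfying an equation $f^k+c_1f^{k-1}+\cdots+c_{k-1}f+c_k=0$ with $c_i\in J^i$; for a monomial ideal it is again a monomial ideal. *)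

(* Defs.v *)
From HB Require Import structures.
From Stdlib Require Import ClassicalEpsilon.
From mathcomp Require Import all_boot all_order all_algebra.
From mathcomp.multinomials Require Import mpoly.

Set Implicit Arguments.
Unset Strict Implicit.
Unset Printing Implicit Defensive.

Import GRing.Theory.
Local Open Scope ring_scope.

(* Ideals are Prop-valued predicates: membership in an integral closure is not
   given by a boolean test. *)

Section Ideals.
Variable R : comNzRingType.
Implicit Types (G I J : R -> Prop) (f g : R).

Definition ideal_gen G f : Prop :=
  exists (r : nat) (a g : 'I_r -> R),
    (forall k, G (g k)) /\ f = \sum_(k < r) a k * g k.

Definition ideal_mul I J : R -> Prop :=
  ideal_gen (fun f => exists g h, [/\ I g, J h & f = g * h]).

Fixpoint ideal_exp I (k : nat) : R -> Prop :=
  if k is k'.+1 then ideal_mul I (ideal_exp I k') else fun _ => True.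

(* [c i] is the coefficient c_(i+1) of the equation of integral dependence
   f^k + c_1 f^(k-1) + ... + c_k = 0. *)
Definition integral_closure J f : Prop :=
  exists (k : nat) (c : 'I_k -> R),
    [/\ (0 < k)%N,
        forall i : 'I_k, ideal_exp J i.+1 (c i)
      & f ^+ k + \sum_(i < k) c i * f ^+ (k - i.+1) = 0].

End Ideals.

Section Monomial.
Variables (K : fieldType) (n : nat).
Local Notation S := {mpoly K[n]}.
Implicit Types (I J : S -> Prop) (u v : 'X_{1..n}).

Definition monomial_ideal I : Prop :=
  exists A : 'X_{1..n} -> Prop,
    forall f, I f <-> ideal_gen (fun g => exists2 u, A u & g = 'X_[u]) f.

(* G(I): the monomials of I that are minimal for divisibility. *)
Definition min_gen I u : Prop :=
  I 'X_[u] /\ forall v, I 'X_[v] -> (v <= u)%MM -> v = u.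

Definition is_gamma I (g : nat) : Prop :=
  (exists u (j : 'I_n), [/\ min_gen I u, (0 < u j)%N & g = u j]) /\
  (forall u (j : 'I_n), min_gen I u -> (0 < u j)%N -> (g <= u j)%N).

(* The minimum exists as soon as I is a proper nonzero monomial ideal. *)
Definition gamma I : nat := epsilon (inhabits 0%N) (is_gamma I).

(* Data of a sequence ... -> F_1 -> F_0 -> S of graded free modules, where
   F_i = \bigoplus_(k < gr_rank i) S(-(gr_deg i k)).  Elements of F_i are row
   vectors and the maps act by right multiplication. *)
Record free_sequence := FreeSequence {
  gr_rank : nat -> nat;
  gr_deg : forall i, 'I_(gr_rank i) -> int;
  gr_diff : forall i, 'M[S]_(gr_rank i.+1, gr_rank i);
  gr_aug : 'cV[S]_(gr_rank 0)
}.

(* The maps are homogeneous of degree 0: a nonzero (k, l) entry is a form of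
   degree deg(e_k) - deg(e_l). *)
Definition is_graded (F : free_sequence) : Prop :=
  (forall k u, u \in msupp (gr_aug F k 0) -> gr_deg k = (mdeg u)%:Z) /\
  (forall i (k : 'I_(gr_rank F i.+1)) (l : 'I_(gr_rank F i)) u,
     u \in msupp (gr_diff F i k l) -> gr_deg k = gr_deg l + (mdeg u)%:Z).

(* ... -> F_1 -> F_0 -> J -> 0 is exact: J itself, not S/J, is resolved. *)
Definition is_resolution J (F : free_sequence) : Prop :=
  [/\ forall f, J f <-> exists v : 'rV_(gr_rank F 0), f = (v *m gr_aug F) 0 0,
      forall v : 'rV_(gr_rank F 0),
        v *m gr_aug F = 0 <-> exists w, v = w *m gr_diff F 0
    & forall i (v : 'rV_(gr_rank F i.+1)),
        v *m gr_diff F i = 0 <-> exists w, v = w *m gr_diff F i.+1].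

(* The image of F_(i+1) lies in (x_1, ..., x_n) F_i. *)
Definition is_minimal (F : free_sequence) : Prop :=
  forall i (k : 'I_(gr_rank F i.+1)) (l : 'I_(gr_rank F i)),
    (gr_diff F i k l)@_0%MM = 0.

Definition minimal_graded_free_resolution J (F : free_sequence) : Prop :=
  [/\ is_graded F, is_resolution J F & is_minimal F].

Definition betti (F : free_sequence) (i : nat) (j : int) : nat :=
  #|[pred k : 'I_(gr_rank F i) | gr_deg k == j]|.

(* [is_reg J r] says reg(J) = r.  Minimal graded free resolutions exist, are
   finite, and are unique up to isomorphism, so r is unique and exists when J
   is a nonzero homogeneous ideal. *)
Definition is_reg J (r : int) : Prop :=
  exists F : free_sequence,
    [/\ minimal_graded_free_resolution J F,
        exists i j, betti F i j <> 0%N /\ r = j - i%:Z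
      & forall i j, betti F i j <> 0%N -> j - i%:Z <= r].

End Monomial.

(* Main.v *)
From Stdlib Require Import ClassicalEpsilon.
Require Import Defs.
From mathcomp Require Import all_boot all_order all_algebra.
From mathcomp.multinomials Require Import mpoly.
From mathcomp Require Import zify.

(* By local duality, reg J is the maximum of |a| + p over the multidegrees a and
   the p with H^p_m(J)_a <> 0, and for a monomial ideal H^p_m(J)_a is the
   cohomology of the set of faces F such that x^a lies in the localization of J
   at the variables in F.  At a maximum, a has no entry below -1.  Write
   J_k for the integral closure of I^k; x^v lies in J_s iff x^(m v) lies in
   J_(s m).  Let b be the sum of the nonnegative entries of a multidegree a
   attaining reg J_s, and g = gamma I.
   If b >= g s, multiply the nonnegative entries of a by m: the faces for
   J_(s m) are those for J_s, and |a| grows by (m - 1) b >= g s (m - 1).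
   If b < g s, then F is a face iff it contains the negative entries and I
   becomes the unit ideal after inverting the variables in F; for J_(s m) the
   same holds as long as b < g s m, so one nonnegative entry of a can be
   increased until b = g s m - 1.
   Local cohomology is computed by Koszul complexes on x_1^t, ..., x_n^t with t
   large, and compared to a free resolution by chasing classes through the
   syzygies. *)

Set Implicit Arguments.
Unset Strict Implicit.
Unset Printing Implicit Defensive.

Import GRing.Theory Order.TTheory.
Local Open Scope ring_scope.

(** * Signed cochains on sets of variables, and cones *)

Section Cochains.
Variables (n : nat) (V : zmodType).
Implicit Types (c : {set 'I_n} -> V) (F : {set 'I_n}) (j k : 'I_n).

Definition sgn (b : bool) (x : V) : V := if b then - x else x.

Definition pos j F : nat := #|[set k in F | (k < j)%N]|.

Definition cobd c F : V := \sum_(j in F) sgn (odd (pos j F)) (c (F :\ j)).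

Lemma sgnK b x : sgn b (sgn b x) = x.
Proof. by case: b => //=; rewrite opprK. Qed.

Lemma sgn_comp a b x : sgn a (sgn b x) = sgn (a (+) b) x.
Proof. by case: a; case: b; rewrite //= opprK. Qed.

Lemma sgn0 b : sgn b 0 = 0.
Proof. by case: b; rewrite //= oppr0. Qed.

Lemma sgn_sum b (T : finType) (A : pred T) (f : T -> V) :
  sgn b (\sum_(i | A i) f i) = \sum_(i | A i) sgn b (f i).
Proof. by case: b; rewrite //= sumrN. Qed.

Lemma posD1 j k F : k \in F ->
  pos j F = ((k < j)%N + pos j (F :\ k))%N.
Proof.
move=> kF; rewrite /pos (cardsD1 k [set i in F | _]) inE kF /=; congr (_ + _)%N.
by apply: eq_card => i; rewrite !inE; case: (i == k).
Qed.

Lemma pos_id j F : pos j (F :\ j) = pos j F.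
Proof.
by apply: eq_card => i; rewrite !inE; case: eqP => [->|//]; rewrite ltnn !andbF.
Qed.

Lemma odd_pos_swap j k F : j \in F -> k \in F -> j != k ->
  odd (pos j F) (+) odd (pos k (F :\ j)) =
  ~~ (odd (pos k F) (+) odd (pos j (F :\ k))).
Proof.
move=> jF kF jk; rewrite (posD1 j kF) (posD1 k jF) !oddD !oddb.
have : (k < j)%N = ~~ (j < k)%N.
  by move: jk; rewrite -(inj_eq val_inj) /=; lia.
by move=> ->; case: (j < k)%N; do 2!case: odd.
Qed.

(** Removing [j] then [k] and removing [k] then [j] reach the same set with opposite signs
    ([odd_pos_swap]), so the terms with [j < k] cancel those with [k < j]. *)
Lemma cobd_cobd c F : cobd (cobd c) F = 0.
Proof.
pose f j k := sgn (odd (pos j F) (+) odd (pos k (F :\ j))) (c (F :\ j :\ k)).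
have -> : cobd (cobd c) F =
    \sum_(j in F) \sum_(k in F | k != j) f j k.
  apply: eq_bigr => j jF; rewrite /cobd sgn_sum.
  by apply: eq_big => [k|k _]; [rewrite !inE andbC | rewrite sgn_comp].
have split2 j : \sum_(k in F | k != j) f j k =
    \sum_(k in F | (k < j)%N) f j k + \sum_(k in F | (j < k)%N) f j k.
  rewrite (bigID (fun k : 'I_n => k < j)%N) /=; congr (_ + _);
    apply: eq_bigl => k; rewrite -andbA; congr (_ && _);
    rewrite -(inj_eq val_inj) /=; lia.
under eq_bigr do rewrite split2.
rewrite big_split /= (exchange_big_dep (mem F)) /=; last by move=> j k _ /andP[].
have -> : \sum_(j in F) \sum_(i in F | (j \in F) && (j < i)%N) f i j =
   \sum_(j in F) \sum_(k in F | (j < k)%N) - f j k.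
  apply: eq_bigr => j jF; apply: eq_big => [k|k]; first by rewrite jF.
  move=> /and3P[kF _ jk]; rewrite /f setDDl setDDl setUC.
  rewrite (odd_pos_swap kF jF); last by rewrite -(inj_eq val_inj) /=; lia.
  by case: (_ (+) _); rewrite //= ?opprK.
by rewrite -big_split /= big1 // => j jF; rewrite -big_split big1 //= => k _; rewrite addNr.
Qed.

Lemma eq_cobd c c' : c =1 c' -> cobd c =1 cobd c'.
Proof. by move=> e F; apply: eq_bigr => j _; rewrite e. Qed.

Lemma cobdB c c' F : cobd (fun G => c G - c' G) F = cobd c F - cobd c' F.
Proof.
by rewrite -sumrB; apply: eq_bigr => j _; case: odd; rewrite //= opprD.
Qed.

Lemma cobd0 c : (forall F, c F = 0) -> forall F, cobd c F = 0.
Proof. by move=> c0 F; rewrite /cobd big1 // => j _; rewrite c0 sgn0. Qed.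

(* The contracting homotopy of the simplicial cone with apex [a]. *)
Definition cone a c F : V :=
  if a \in F then 0 else sgn (odd (pos a F)) (c (a |: F)).

(** When [a] is in [F], only the term at [a] survives and its two signs cancel. Otherwise the
    cocycle condition at [a |: F] expresses [c F] through the values of [c] on sets containing
    [a]. *)
Lemma cobd_cone a c : (forall F, cobd c F = 0) -> cobd (cone a c) =1 c.
Proof.
move=> dc0 F; case: (boolP (a \in F)) => aF.
  rewrite /cobd (bigD1 a) //= big1 => [|j /andP[jF ja]]; last first.
    by rewrite /cone !inE eq_sym ja aF sgn0.
  by rewrite addr0 /cone !inE eqxx /= setD1K // pos_id sgnK.
have := dc0 (a |: F); rewrite /cobd (bigD1 a) /=; last by rewrite !inE eqxx.
rewrite setU1K // -pos_id setU1K // => e.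
have -> : c F = sgn (odd (pos a F)) (sgn (odd (pos a F)) (c F)) by rewrite sgnK.
move: e => /eqP; rewrite addr_eq0 => /eqP ->; rewrite -sumrN sgn_sum.
apply: eq_big => [j|j jF].
  rewrite !inE; case: eqVneq => [->|]; rewrite ?andbT //=.
  by rewrite (negbTE aF).
have ja : j != a by apply: contraNneq aF => <-.
rewrite /cone !inE (negbTE aF) andbF !sgn_comp.
have jaF : j \in a |: F by rewrite !inE jF orbT.
have -> : (a |: F) :\ j = a |: (F :\ j).
  by apply/setP => i; rewrite !inE; case: (eqVneq i a) => [->|//]; rewrite eq_sym ja.
have aaF : a \in a |: F by rewrite !inE eqxx.
have := odd_pos_swap aaF jaF; rewrite eq_sym ja => /(_ isT).
rewrite setU1K // -pos_id setU1K //.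
have -> : pos a ((a |: F) :\ j) = pos a (F :\ j).
  rewrite -pos_id; congr pos; apply/setP => i; rewrite !inE.
  by case: (eqVneq i a) => [->|//]; rewrite (negbTE aF) andbF.
case: (odd (pos a F)); case: (odd (pos j (a |: F))); case: (odd (pos j F));
  case: (odd (pos a (F :\ j))) => //= _; by rewrite ?opprK.
Qed.

End Cochains.

Lemma cobd_add (n : nat) (V W : zmodType) (f : {additive V -> W})
    (c : {set 'I_n} -> V) F :
  f (cobd c F) = cobd (fun G => f (c G)) F.
Proof. by rewrite raddf_sum; apply: eq_bigr => j _; case: odd; rewrite //= raddfN. Qed.

Lemma choice_fun (T U : Type) (R : T -> U -> Prop) :
  (forall x, exists y, R x y) -> exists f : T -> U, forall x, R x (f x).
Proof.
move=> h; exists (fun x => proj1_sig (constructive_indefinite_description _ (h x))).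
by move=> x; case: constructive_indefinite_description.
Qed.

(** * Cohomology of an up-closed family of faces *)

Section SimplicialCohomology.
Variables (K : fieldType) (n : nat).
Implicit Types (N : {set 'I_n} -> Prop) (c : {set 'I_n} -> K).

(* Degrees are shifted by one, so that [supported N 0] is the zero module. *)
Definition supported N p c : Prop := forall F, c F <> 0 -> N F /\ #|F|.+1 = p.

(* [N] is an up-closed family of faces, i.e. the complement of a simplicial
   complex, and the cohomology is that of the full simplex relative to it. *)
Definition has_cohomology N p : Prop :=
  exists c, [/\ supported N p.+1 c, forall F, cobd c F = 0
    & ~ exists b, supported N p b /\ c =1 cobd b].

Lemma has_cohomology_ext N N' p : (forall F, N F <-> N' F) ->
  has_cohomology N p -> has_cohomology N' p.
Proof.
move=> e [c [sc dc nb]]; exists c; split=> //.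
  by move=> F /sc[/e].
by move=> [b [sb cb]]; apply: nb; exists b; split=> // F /sb[/e].
Qed.

(** The hypothesis is what keeps the cone homotopy with apex [a] supported on [N], so every cocycle
    bounds inside [N]. *)
Lemma apex_no_cohomology N a p :
  (forall F, N (a |: F) -> N F) -> ~ has_cohomology N p.
Proof.
move=> Na [c [sc dc nb]]; apply: nb; exists (cone a c); split; last first.
  by move=> F; rewrite cobd_cone.
move=> F; rewrite /cone; case: (boolP (a \in F)) => // aF ne0.
have /sc[/Na NF] : c (a |: F) <> 0.
  by move=> e; apply: ne0; rewrite e sgn0.
by rewrite cardsU1 aF => -[].
Qed.

Lemma has_cohomology_le N p : has_cohomology N p -> (p <= n)%N.
Proof.
move=> [c [sc dc nb]]; rewrite leqNgt; apply/negP => np; apply: nb.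
have c0 F : c F = 0.
  case: (eqVneq (c F) 0) => // /eqP /sc[_ /succn_inj e].
  by have : (#|F| <= #|'I_n|)%N := max_card _; rewrite card_ord; lia.
exists (fun=> 0); split=> [F /eqP|F]; first by rewrite eqxx.
by rewrite c0 cobd0.
Qed.

Lemma no_cohomology_cobd N p c : ~ has_cohomology N p ->
  supported N p.+1 c -> (forall F, cobd c F = 0) ->
  exists b, supported N p b /\ c =1 cobd b.
Proof. by move=> nH sc dc; apply: NNPP => nb; apply: nH; exists c. Qed.

End SimplicialCohomology.

(** * Coefficients, filtering by exponents and division by monomials *)

Section Monomials.
Variables (R : comNzRingType) (n : nat).
Implicit Types (f g : {mpoly R[n]}) (u v m : 'X_{1..n}).

Lemma mcoeff_sumX (U : seq 'X_{1..n}) (a : 'X_{1..n} -> R) u : uniq U ->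
  (\sum_(v <- U) a v *: 'X_[v])@_u = if u \in U then a u else 0.
Proof.
move=> uU; rewrite raddf_sum /=.
under eq_bigr do rewrite mcoeffZ mcoeffX.
case: ifP => uin.
  rewrite (bigD1_seq u) //= eqxx mulr1 big1 ?addr0 // => v /negbTE ->.
  by rewrite mulr0.
rewrite big_seq big1 // => v vin; case: eqP => [e|]; last by rewrite mulr0.
by rewrite e uin in vin.
Qed.

Definition mfilter (P : pred 'X_{1..n}) f :=
  \sum_(v <- msupp f) (if P v then f@_v else 0) *: 'X_[v].

Lemma mcoeff_filter P f u : (mfilter P f)@_u = if P u then f@_u else 0.
Proof.
rewrite mcoeff_sumX ?msupp_uniq // mcoeff_msupp.
by case: eqP => [->|//]; case: (P u).
Qed.

(** This makes homogeneous projection commute with multiplication by a form: [Q] is [P] shifted by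
    the degree of [g]. *)
Lemma mfilter_mul P Q f g :
  (forall u v, g@_v <> 0 -> P (u + v)%MM = Q u) ->
  mfilter P (f * g) = mfilter Q f * g.
Proof.
move=> PQ; apply/mpolyP => u; rewrite mcoeff_filter !mcoeffM.
case: ifP => Pu; last first.
  rewrite big1 // => k /eqP e; rewrite mcoeff_filter.
  case: (eqVneq g@_k.2 0) => [->|/eqP /(PQ k.1)]; first by rewrite mulr0.
  by rewrite -e Pu => <-; rewrite mul0r.
apply: eq_bigr => k /eqP e; rewrite mcoeff_filter.
case: (eqVneq g@_k.2 0) => [->|/eqP /(PQ k.1)]; first by rewrite !mulr0.
by rewrite -e Pu => <-.
Qed.

Lemma divX m f : (forall u, f@_u <> 0 -> (m <= u)%MM) ->
  exists w, f = 'X_[m] * w.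
Proof.
move=> mf; exists (\sum_(v <- msupp f) f@_v *: 'X_[v - m]).
rewrite {1}[f]mpolyE mulr_sumr big_seq [RHS]big_seq; apply: eq_bigr => v.
rewrite mcoeff_msupp => /eqP /mf mv.
by rewrite -scalerAr -mpolyXD addmC submK.
Qed.

Lemma mcoeffXM m f u : ('X_[m] * f)@_u = if (m <= u)%MM then f@_(u - m) else 0.
Proof.
rewrite mulrC; case: ifP => mu.
  by rewrite -{1}(submK mu) addmC mcoeffMX.
apply/eqP; apply/negPn; rewrite -mcoeff_msupp (perm_mem (msuppMX _ _)).
by apply/mapP => -[v _ e]; rewrite e lem_addr in mu.
Qed.

Lemma mulX_eq0 m f : 'X_[m] * f = 0 -> f = 0.
Proof.
move=> e; apply/mpolyP => u; rewrite mcoeff0.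
by rewrite -(mcoeffMX f m u) mulrC e; exact: mcoeff0.
Qed.

End Monomials.

(** * Multidegrees shifted by [t], and their faces *)

Section Multidegrees.
Variable n : nat.
Implicit Types (u v : 'X_{1..n}) (F : {set 'I_n}).

(** After multiplication by the t-th power of the product of all variables, the denominator attached
    to [F] leaves exactly this monomial. *)
Definition mcompl t F : 'X_{1..n} := [multinom (if j \in F then 0%N else t) | j < n].

Lemma mcomplE t F j : mcompl t F j = if j \in F then 0%N else t.
Proof. by rewrite mnmE. Qed.

Lemma mcomplP t F u : reflect (forall j, j \notin F -> (t <= u j)%N) (mcompl t F <= u)%MM.
Proof.
apply: (iffP mnm_lepP) => h j; last by rewrite mcomplE; case: ifP => // /negbT /h.
by move=> jF; have := h j; rewrite mcomplE (negbTE jF).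
Qed.

Lemma mcomplT t : mcompl t setT = 0%MM.
Proof. by apply/mnmP => j; rewrite mcomplE inE mnm0E. Qed.

Lemma mcompl_sub t F F' : F \subset F' -> (mcompl t F' <= mcompl t F)%MM.
Proof.
move=> FF; apply/mcomplP => j jF; rewrite mcomplE; case: ifP => // /(subsetP FF).
by rewrite (negbTE jF).
Qed.

(* The faces [F] for which [x^(u - t)] lies in the localization at [prod_F x_j]
   of the monomials satisfying [P], with denominators bounded by [x_j^t]. *)
Definition faces (P : 'X_{1..n} -> Prop) t u F : Prop :=
  (mcompl t F <= u)%MM /\ P (u - mcompl t F)%MM.

End Multidegrees.

(** * Koszul complexes, one multidegree at a time *)

Section Multigraded.
Variables (K : fieldType) (n : nat).
Local Notation S := {mpoly K[n]}.

(** The differential does not mix multidegrees, so a bounding cochain is found over [K] for each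
    [u]; only the finitely many exponents [U] occurring in [c] are kept, which makes the glued
    cochain polynomial. *)
Lemma multigraded_coboundary (P : 'X_{1..n} -> Prop) t p (c : {set 'I_n} -> S) :
  (forall F u, (c F)@_u <> 0 -> faces P t u F /\ #|F|.+1 = p.+1) ->
  (forall F, cobd c F = 0) ->
  (forall F u, (c F)@_u <> 0 -> ~ has_cohomology K (faces P t u) p) ->
  exists b : {set 'I_n} -> S,
    (forall F u, (b F)@_u <> 0 -> faces P t u F /\ #|F|.+1 = p) /\ c =1 cobd b.
Proof.
move=> sc dc nH.
have /choice_fun[B hB] u : exists b : {set 'I_n} -> K,
    supported (faces P t u) p b /\ (fun F => (c F)@_u) =1 cobd b.
  case: (classic (exists F, (c F)@_u <> 0)) => [[F /nH h]|h].
    apply: no_cohomology_cobd h _ _ => [G /sc //|G].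
    by rewrite -(cobd_add (mcoeff u)) dc; apply: mcoeff0.
  exists (fun=> 0); split=> [F /eqP|F]; first by rewrite eqxx.
  by rewrite cobd0 //; apply: NNPP => e; apply: h; exists F.
pose U := undup (flatten [seq msupp (c F) | F : {set 'I_n}]).
pose b F := \sum_(v <- U) B v F *: 'X_[v].
have bE F u : (b F)@_u = if u \in U then B u F else 0.
  by rewrite /b mcoeff_sumX ?undup_uniq.
exists b; split=> [F u|F].
  rewrite bE; case: ifP => [_|_ /eqP]; last by rewrite eqxx.
  by have [h _] := hB u => /h.
apply/mpolyP => u; rewrite (cobd_add (mcoeff u)).
case: (boolP (u \in U)) => uU.
  by have [_ ->] := hB u; apply: eq_cobd => G /=; rewrite bE uU.
rewrite cobd0 => [|G] /=; last by rewrite bE (negbTE uU).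
apply/eqP; rewrite mcoeff_eq0; apply: contra uU => uF.
rewrite mem_undup; apply/flattenP; exists (msupp (c F)) => //.
by apply/mapP; exists F; rewrite ?mem_enum.
Qed.

(* Cochains of the Koszul complex of a free module on [x_1^t, ..., x_n^t]:
   clearing denominators, the component at [F] is divisible by
   [prod_(j notin F) x_j^t] and the differential is the simplicial one. *)
Definition koszul t p r (c : {set 'I_n} -> 'rV[S]_r) : Prop :=
  forall F k u, (c F 0 k)@_u <> 0 -> (mcompl t F <= u)%MM /\ #|F|.+1 = p.

Lemma cobd_entry r (c : {set 'I_n} -> 'rV[S]_r) F k :
  cobd c F 0 k = cobd (fun G => c G 0 k) F.
Proof.
rewrite /cobd summxE; apply: eq_bigr => j _; case: odd => //=.
by rewrite mxE.
Qed.

Lemma cobd_mulmx r r' (c : {set 'I_n} -> 'rV[S]_r) (A : 'M[S]_(r, r')) F :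
  cobd c F *m A = cobd (fun G => c G *m A) F.
Proof.
rewrite /cobd mulmx_suml; apply: eq_bigr => j _; case: odd => //=.
by rewrite mulNmx.
Qed.

Lemma koszul_entry t p r (c : {set 'I_n} -> 'rV[S]_r) : koszul t p c ->
  forall F, (exists w, c F = 'X_[mcompl t F] *: w) /\ (#|F|.+1 = p \/ c F = 0).
Proof.
move=> kc F; split.
  have /choice_fun[w hw] k : exists w, c F 0 k = 'X_[mcompl t F] * w.
    by apply: divX => u /kc[].
  by exists (\row_k w k); apply/rowP => k; rewrite !mxE.
case: (eqVneq #|F|.+1 p) => [|/eqP ne]; first by left.
right; apply/rowP => k; rewrite mxE; apply/mpolyP => u; rewrite mcoeff0.
by apply: NNPP => /kc[].
Qed.

Lemma koszul_cobd t p r (c : {set 'I_n} -> 'rV[S]_r) :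
  koszul t p c -> koszul t p.+1 (cobd c).
Proof.
move=> kc F k u; rewrite cobd_entry (cobd_add (mcoeff u)) => ne.
have [j [jF cj]] : exists j, j \in F /\ (c (F :\ j) 0 k)@_u <> 0.
  apply: NNPP => h; apply: ne; rewrite /cobd big1 // => j jF.
  have e : (c (F :\ j) 0 k)@_u = 0 by apply: NNPP => e; apply: h; exists j.
  by rewrite /= e sgn0.
have [h1 h2] := kc _ _ _ cj; split.
  by apply: lepm_trans h1; apply: mcompl_sub; apply: subD1set.
by rewrite (cardsD1 j) jF add1n h2.
Qed.

Lemma koszulB t p r (c c' : {set 'I_n} -> 'rV[S]_r) :
  koszul t p c -> koszul t p c' -> koszul t p (fun F => c F - c' F).
Proof.
move=> kc kc' F k u; rewrite !mxE mcoeffB.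
case: (eqVneq (c F 0 k)@_u 0) => [->|/eqP /kc //].
by case: (eqVneq (c' F 0 k)@_u 0) => [->|/eqP /kc' //]; rewrite subr0.
Qed.

Lemma koszulX t p r (w : {set 'I_n} -> 'rV[S]_r) :
  koszul t p (fun F => if #|F|.+1 == p then 'X_[mcompl t F] *: w F else 0).
Proof.
move=> F k u; case: eqP => [e|_]; last by rewrite mxE mcoeff0.
by rewrite mxE mcoeffXM; case: ifP.
Qed.

Lemma koszul_mulmx t p r r' (c : {set 'I_n} -> 'rV[S]_r) (A : 'M[S]_(r, r')) :
  koszul t p c -> koszul t p (fun F => c F *m A).
Proof.
move=> kc; have h := koszul_entry kc.
move=> F k u; have [[w e] [e2|e2]] := h F.
  by rewrite e -scalemxAl mxE mcoeffXM; case: ifP.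
by rewrite e2 mul0mx mxE mcoeff0.
Qed.

(** An index [j] with [t <= u j] is an apex. If there is none, the full set is the only face, and it
    lives in cohomological degree [n]. *)
Lemma faces_full_no_cohomology t (u : 'X_{1..n}) p :
  (p < n)%N \/ (exists j, (t <= u j)%N) ->
  ~ has_cohomology K (faces (fun=> True) t u) p.
Proof.
case: (classic (exists j, (t <= u j)%N)) => [[j tj] _|nj [pn|//]].
  apply: (apex_no_cohomology (a := j)) => F [/mcomplP h _]; split=> //.
  apply/mcomplP => i iF; case: (eqVneq i j) => [->//|ij].
  by apply: h; rewrite !inE negb_or ij.
move=> [c [sc dc nb]]; apply: nb; exists (fun=> 0); split=> [F /eqP|F].
  by rewrite eqxx.
rewrite [RHS]cobd0 //; apply: NNPP => /sc[[/mcomplP h _] /succn_inj e].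
have [j jF] : exists j, j \notin F.
  apply/existsP; apply: contraLR pn => /pred0Pn h'; rewrite -leqNgt -e.
  rewrite -[X in (X <= _)%N](card_ord n); apply/subset_leq_card/subsetP => j _.
  by apply/negPn/negP => jF; apply: h'; exists j.
by apply: nj; exists j; apply: h.
Qed.

(** This reflects that the t-th powers of the variables form a regular sequence: there is no
    cohomology below degree [n], and in degree [n] the monomials in the ideal of these powers are
    boundaries. *)
Lemma koszul_exact t p r (c : {set 'I_n} -> 'rV[S]_r) :
  koszul t p.+1 c -> (forall F, cobd c F = 0) ->
  (p < n)%N \/ (forall F k u, (c F 0 k)@_u <> 0 -> exists j, (t <= u j)%N) ->
  exists b : {set 'I_n} -> 'rV[S]_r, koszul t p b /\ c =1 cobd b.
Proof.
move=> kc dc hp.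
have /choice_fun[B hB] k : exists b : {set 'I_n} -> S,
    (forall F u, (b F)@_u <> 0 -> faces (fun=> True) t u F /\ #|F|.+1 = p) /\
    (fun F => c F 0 k) =1 cobd b.
  apply: multigraded_coboundary => [F u /kc[]//|F|F u cu].
    by rewrite -cobd_entry dc mxE.
  apply: faces_full_no_cohomology; case: hp => [|h]; first by left.
  by right; apply: h cu.
exists (fun F => \row_k B k F); split=> [F k u|F].
  by rewrite mxE; have [h _] := hB k => /h[[]].
apply/rowP => k; rewrite cobd_entry; have [_ ->] := hB k.
by apply: eq_cobd => G; rewrite mxE.
Qed.

End Multigraded.

(** * Chasing Koszul classes through the syzygies of a graded resolution *)

Section Resolution.
Variables (K : fieldType) (n : nat).
Local Notation S := {mpoly K[n]}.
Variables (rk : nat -> nat) (dg : forall i, 'I_(rk i) -> int)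
  (D : forall i, 'M[S]_(rk i.+1, rk i)) (r : int).
Hypothesis D_graded : forall i (k : 'I_(rk i.+1)) (l : 'I_(rk i)) u,
  (D i k l)@_u <> 0 -> dg k = dg l + (mdeg u)%:Z.
Hypothesis D_exact : forall i (v : 'rV_(rk i.+1)),
  v *m D i = 0 <-> exists w, v = w *m D i.+1.
Hypothesis D_minimal : forall i k l, (D i.+1 k l)@_0%MM = 0.
Hypothesis dg_bound : forall i (k : 'I_(rk i.+1)), dg k <= r + i%:Z.

Definition has_degree i (a : int) (v : 'rV[S]_(rk i)) : Prop :=
  forall k u, (v 0 k)@_u <> 0 -> dg k + (mdeg u)%:Z = a.

Definition of_degree i (a : int) (k : 'I_(rk i)) : pred 'X_{1..n} :=
  fun u => dg k + (mdeg u)%:Z == a.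

Definition hproj i (a : int) (v : 'rV[S]_(rk i)) : 'rV[S]_(rk i) :=
  \row_k mfilter (of_degree a k) (v 0 k).

Lemma hproj_homog i a (v : 'rV_(rk i)) : has_degree a (hproj a v).
Proof. by move=> k u; rewrite mxE mcoeff_filter; case: (of_degree a k u) / eqP. Qed.

Lemma hproj_id i a (v : 'rV_(rk i)) : has_degree a v -> hproj a v = v.
Proof.
move=> hv; apply/rowP => k; rewrite mxE; apply/mpolyP => u.
rewrite mcoeff_filter; case: (of_degree a k u) / eqP => // ne.
by case: (eqVneq (v 0 k)@_u 0) => // /eqP /hv.
Qed.

Lemma hproj_mul i a (w : 'rV_(rk i.+1)) : hproj a (w *m D i) = hproj a w *m D i.
Proof.
apply/rowP => l; rewrite !mxE; apply/mpolyP => u.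
rewrite mcoeff_filter !raddf_sum /=.
transitivity (\sum_k
   (mfilter (of_degree a l) (w 0 k * D i k l))@_u).
  case: ifP => h; last by rewrite big1 // => k _; rewrite mcoeff_filter h.
  by apply: eq_bigr => k _; rewrite mcoeff_filter h.
apply: eq_bigr => k _; rewrite mxE; congr (_@_u); apply: mfilter_mul => v v'.
move=> /D_graded e; rewrite /of_degree e mdegD; lia.
Qed.

Lemma hproj_cobd i a (c : {set 'I_n} -> 'rV_(rk i)) F :
  hproj a (cobd c F) = cobd (fun G => hproj a (c G)) F.
Proof.
apply/rowP => k; rewrite cobd_entry mxE cobd_entry; apply/mpolyP => u.
rewrite mcoeff_filter !(cobd_add (mcoeff u)) /=.
case: ifP => h.
  by apply: eq_cobd => G; rewrite /= mxE mcoeff_filter h.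
by rewrite cobd0 // => G; rewrite /= mxE mcoeff_filter h.
Qed.

Lemma koszul_hproj t p i a (c : {set 'I_n} -> 'rV_(rk i)) :
  koszul t p c -> koszul t p (fun F => hproj a (c F)).
Proof.
by move=> kc F k u; rewrite mxE mcoeff_filter; case: ifP => // _ /kc.
Qed.

Lemma cobd_homog i a (c : {set 'I_n} -> 'rV_(rk i)) F :
  (forall G, has_degree a (c G)) -> has_degree a (cobd c F).
Proof.
move=> hc; have -> : cobd c F = hproj a (cobd c F).
  by rewrite hproj_cobd; apply: eq_cobd => G; rewrite hproj_id.
exact: hproj_homog.
Qed.

Lemma mul_homog i a (v : 'rV_(rk i.+1)) : has_degree a v -> has_degree a (v *m D i).
Proof. by move=> hv; rewrite -(hproj_id hv) -hproj_mul; exact: hproj_homog. Qed.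

Lemma D_comp i (v : 'rV_(rk i.+2)) : v *m D i.+1 *m D i = 0.
Proof. by apply/D_exact; exists v. Qed.

(** Each component is first divided by its monomial factor, a nonzerodivisor, and the quotient is
    lifted by exactness; multiplying back keeps the lift in the Koszul complex. *)
Lemma koszul_lift t p i (x : {set 'I_n} -> 'rV_(rk i.+1)) :
  koszul t p x -> (forall F, x F *m D i = 0) ->
  exists y : {set 'I_n} -> 'rV_(rk i.+2),
    koszul t p y /\ forall F, x F = y F *m D i.+1.
Proof.
move=> kx x0; have kx' := koszul_entry kx.
have /choice_fun[w hw] F : exists w : 'rV_(rk i.+2),
    x F = 'X_[mcompl t F] *: w *m D i.+1.
  have [[v e] _] := kx' F.
  have /D_exact[w e'] : v *m D i = 0.
    apply/rowP => k; have /rowP/(_ k) := x0 F.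
    by rewrite e -scalemxAl !mxE => /mulX_eq0.
  by exists w; rewrite e e' scalemxAl.
exists (fun F : {set 'I_n} => if #|F|.+1 == p then 'X_[mcompl t F] *: w F else 0); split.
  exact: koszulX.
move=> F; case: eqP => [_|ne]; first by rewrite hw.
by have [_ [//|->]] := kx' F; rewrite mul0mx.
Qed.

Lemma koszul_lift_homog t p i a (x : {set 'I_n} -> 'rV_(rk i.+1)) :
  koszul t p x -> (forall F, x F *m D i = 0) -> (forall F, has_degree a (x F)) ->
  exists y : {set 'I_n} -> 'rV_(rk i.+2),
    [/\ koszul t p y, forall F, has_degree a (y F) & forall F, x F = y F *m D i.+1].
Proof.
move=> kx x0 hx; have [y [ky xy]] := koszul_lift kx x0.
exists (fun F => hproj a (y F)); split=> [|F|F]; first exact: koszul_hproj.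
  exact: hproj_homog.
by rewrite -hproj_mul -xy hproj_id.
Qed.

Lemma koszul_large t p q (c : {set 'I_n} -> 'rV[S]_q) :
  (n < p)%N -> koszul t p.+1 c -> forall F, c F = 0.
Proof.
move=> np kc F; have [_ [/succn_inj e|//]] := koszul_entry kc F.
by have : (#|F| <= #|'I_n|)%N := max_card _; rewrite card_ord; lia.
Qed.

Lemma mdeg_ge_exponent t (u : 'X_{1..n}) :
  (n * t < mdeg u + n)%N -> exists j, (t <= u j)%N.
Proof.
move=> h; apply: NNPP => nj; move: h; rewrite ltnNge => /negP; apply.
have : (\sum_(j < n) (u j).+1 <= \sum_(j < n) t)%N.
  by apply: leq_sum => j _; rewrite ltnNge; apply/negP => tj; apply: nj; exists j.
rewrite sum_nat_const card_ord; apply: leq_trans.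
rewrite mdegE -[X in (_ + X <= _)%N](card_ord n) -sum1_card -big_split /=.
by apply: leq_sum => j _; rewrite addn1.
Qed.

(** Descending induction on [p]. The coboundary of [y] is a syzygy, hence defines a class with [p]
    and [i] both raised by one, which leaves the degree inequality unchanged. Its vanishing corrects
    [y] to a cocycle in the free module, where [koszul_exact] applies. *)
Lemma syzygy_vanishing t p i a (y : {set 'I_n} -> 'rV_(rk i.+1)) :
  koszul t p.+1 y -> (forall F, has_degree a (y F)) ->
  (forall F, cobd (fun G => y G *m D i) F = 0) ->
  r + i%:Z + (n * t)%:Z < a + p%:Z ->
  exists b : {set 'I_n} -> 'rV_(rk i.+1),
    koszul t p b /\ forall F, y F *m D i = cobd (fun G => b G *m D i) F.
Proof.
have [k] := ubnP (n.+1 - p)%N; elim: k => // k IH in p i y *.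
move=> pk ky hy dy lt_a; case: (ltnP n p) => np.
  exists (fun=> 0); split=> [F l u|F]; first by rewrite mxE mcoeff0.
  by rewrite (koszul_large np ky) mul0mx cobd0 // => G; rewrite mul0mx.
have [x [kx hx]] : exists x : {set 'I_n} -> 'rV_(rk i.+1), koszul t p.+1 x /\
    (forall F, cobd x F = 0) /\ ((p < n)%N \/
    (forall F k u, (x F 0 k)@_u <> 0 -> exists j, (t <= u j)%N)) /\
    exists b : {set 'I_n} -> 'rV_(rk i.+1), koszul t p b /\
    forall F, (x F - y F) *m D i = cobd (fun G => b G *m D i) F.
  case: (ltnP p n) => pn; last first.
    have epn : p = n by lia.
    exists y; split=> //; split.
      by apply: (koszul_large _ (koszul_cobd ky)); rewrite epn.
    split; last first.
      exists (fun=> 0); split=> [F l u|F]; first by rewrite mxE mcoeff0.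
      by rewrite subrr mul0mx cobd0 // => G; rewrite mul0mx.
    (* In top degree the inequality makes every monomial too large to have all its exponents below
       [t]. *)
    right=> F l u /hy e; apply: mdeg_ge_exponent.
    by have := dg_bound l; lia.
  have [|||z [kz hz xz]] := @koszul_lift_homog t p.+2 i a (cobd y) _ _ _.
  - exact: koszul_cobd.
  - by move=> F; rewrite cobd_mulmx.
  - by move=> F; apply: cobd_homog.
  have [|||b [kb zb]] := IH p.+1 i.+1 z _ kz hz.
  - by lia.
  - move=> F; rewrite -(cobd_cobd y F); apply: eq_cobd => G; by rewrite xz.
  - by lia.
  (* The correction lies in the image of [D i.+1], so it is invisible after applying [D i]. *)
  exists (fun F : {set 'I_n} => y F - b F *m D i.+1); split.
    by apply: koszulB => //; apply: koszul_mulmx.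
  split; first by move=> F; rewrite cobdB -zb xz subrr.
  split; first by left.
  exists (fun=> 0); split=> [F l u|F]; first by rewrite mxE mcoeff0.
  rewrite cobd0 => [|G]; last by rewrite mul0mx.
  by rewrite addrAC subrr sub0r mulNmx D_comp oppr0.
have [dx [pn [b' [kb' e']]]] := hx.
have [b [kb xb]] := koszul_exact kx dx pn.
exists (fun F : {set 'I_n} => b F - b' F); split; first exact: koszulB.
move=> F; rewrite -[y F](subKr (x F)) mulmxBl e' xb cobd_mulmx -cobdB.
by apply: eq_cobd => G; rewrite mulmxBl.
Qed.

(* A nonzero class of degree [a] in the [p]-th Koszul cohomology of the image
   of [D i], given by a lift [y] of a cocycle. *)
Definition syzygy_class t p i a : Prop :=
  exists y : {set 'I_n} -> 'rV_(rk i.+1),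
  [/\ koszul t p.+1 y, forall F, has_degree a (y F),
      forall F, cobd (fun G => y G *m D i) F = 0
    & ~ exists b : {set 'I_n} -> 'rV_(rk i.+1),
        koszul t p b /\ forall F, y F *m D i = cobd (fun G => b G *m D i) F].

(** Inverse of the connecting map for the image of [D i.+1], the free module containing it, and the
    image of [D i]. The last hypothesis kills the class in the free module, so it comes from one
    cohomological degree lower. *)
Lemma syzygy_class_step t p i a (y : {set 'I_n} -> 'rV_(rk i.+2)) :
  koszul t p.+1 y -> (forall F, has_degree a (y F)) ->
  (forall F, cobd (fun G => y G *m D i.+1) F = 0) ->
  (~ exists b : {set 'I_n} -> 'rV_(rk i.+2),
    koszul t p b /\ forall F, y F *m D i.+1 = cobd (fun G => b G *m D i.+1) F) ->
  (p < n)%N \/ (forall F l u, ((y F *m D i.+1) 0 l)@_u <> 0 ->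
    exists j, (t <= u j)%N) ->
  exists2 q, p = q.+1 & syzygy_class t q i a.
Proof.
move=> ky hy dy nb hp.
have [b0 [kb0 yb0]] := koszul_exact (koszul_mulmx (A := D i.+1) ky) dy hp.
pose b F := hproj a (b0 F).
have kb : koszul t p b by apply: koszul_hproj.
have yb F : y F *m D i.+1 = cobd b F.
  by rewrite -hproj_cobd -yb0 hproj_id //; apply: mul_homog.
have bh F : has_degree a (b F) by apply: hproj_homog.
case: p => [|q] in ky hy dy nb hp kb0 kb *.
  case: nb; exists (fun=> 0); split=> [F l u|F]; first by rewrite mxE mcoeff0.
  rewrite yb [RHS]cobd0 => [|G]; last by rewrite mul0mx.
  rewrite cobd0 // => G; apply/rowP => l; rewrite [RHS]mxE; apply/mpolyP => u.
  by rewrite mcoeff0; apply: NNPP => /kb[].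
exists q => //; exists b; split=> // [F|[b' [kb' bb']]].
  by rewrite -cobd_mulmx -yb D_comp.
(* If the new class bounded through [b'], then [b - cobd b'] would lift to some [z] that bounds the
   original class. *)
have [||z [kz xz]] := @koszul_lift t q.+1 i (fun F => b F - cobd b' F).
- by apply: koszulB => //; apply: koszul_cobd.
- by move=> F; rewrite mulmxBl bb' cobd_mulmx subrr.
apply: nb; exists z; split=> // F.
rewrite yb -[LHS]subr0 -(cobd_cobd b' F) -cobdB.
by apply: eq_cobd => G; rewrite -xz.
Qed.

Lemma syzygy_class_descent t i p a : syzygy_class t p i a -> (p <= n)%N ->
  (p < n)%N \/ i = 0%N ->
  (i <= p)%N /\ syzygy_class t (p - i) 0 a.
Proof.
elim: i p => [|i IH] p h pn hp; first by rewrite subn0.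
have {hp} pn' : (p < n)%N by case: hp.
have [y [ky hy dy nb]] := h.
have [q e hq] := syzygy_class_step ky hy dy nb (or_introl pn').
have [||iq h'] := IH q hq; [by lia|by left; lia|].
by rewrite e subSS.
Qed.

(** The class is the socle monomial [m], all exponents [t - 1], times the generator [e], placed on
    the full set. The hypothesis says that no syzygy involves this monomial at [e], so the class
    survives and can be carried down to [i = 0]. *)
Lemma generator_class t i (e : 'I_(rk i.+1)) : (0 < t)%N ->
  (forall w : 'rV_(rk i.+2),
     ((w *m D i.+1) 0 e)@_[multinom t.-1 | j < n] = 0) ->
  (i <= n)%N /\ syzygy_class t (n - i) 0 (dg e + (n * t.-1)%:Z).
Proof.
move=> t0 he; set m := [multinom _ | _ < _] in he.
pose y (F : {set 'I_n}) : 'rV_(rk i.+1) :=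
  if F == setT then \row_l (if l == e then 'X_[K, m] else 0) else 0.
have yE F l u : (y F 0 l)@_u = ((F == setT) && (l == e) && (m == u))%:R.
  rewrite /y; case: eqP => _ /=; last by rewrite mxE mcoeff0.
  by rewrite mxE; case: eqP => _ /=; rewrite ?mcoeff0 // mcoeffX.
have yP F l u : (y F 0 l)@_u <> 0 -> [/\ F = setT, l = e & u = m].
  rewrite yE; case: eqP => //= ->; case: eqP => //= ->.
  by case: (eqVneq m u) => //= ->.
have ky : koszul t n.+1 y.
  move=> F l u /yP[-> _ _]; rewrite mcomplT cardsT card_ord; split=> //.
  by apply/mnm_lepP => j; rewrite mnm0E.
have hy F : has_degree (dg e + (n * t.-1)%:Z) (y F).
  move=> l u /yP[_ -> ->]; rewrite mdegE.
  under eq_bigr do rewrite mnmE.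
  by rewrite sum_nat_const card_ord.
have dy F : cobd (fun G => y G *m D i) F = 0.
  rewrite /cobd big1 // => j jF; rewrite /y ifN ?mul0mx ?sgn0 //.
  by apply/eqP => /setP/(_ j); rewrite !inE eqxx.
have nb : ~ exists b : {set 'I_n} -> 'rV_(rk i.+1),
    koszul t n b /\ forall F, y F *m D i = cobd (fun G => b G *m D i) F.
  move=> [b [kb yb]].
  have [||z [kz xz]] := @koszul_lift t n.+1 i (fun F => y F - cobd b F).
  - by apply: koszulB => //; apply: koszul_cobd.
  - by move=> F; rewrite mulmxBl yb cobd_mulmx subrr.
  have /rowP/(_ e)/(congr1 (mcoeff m)) := xz setT.
  rewrite he !mxE mcoeffB yE !eqxx /= cobd_entry (cobd_add (mcoeff m)).
  rewrite /cobd big1 ?subr0 => [/eqP|j _]; first by rewrite oner_eq0.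
  (* This component is divisible by the t-th power of the variable [j], which [m] just misses. *)
  have e0 : (b (setT :\ j) 0 e)@_m = 0.
    apply: NNPP => /kb[/mcomplP/(_ j) h _].
    by move: h; rewrite !inE eqxx mnmE => /(_ isT); lia.
  by rewrite /= e0 sgn0.
have h : syzygy_class t n i (dg e + (n * t.-1)%:Z) by exists y.
case: i => [|i] in e he y yE yP ky hy dy nb h *; first by rewrite subn0.
have [|q en hq] := syzygy_class_step ky hy dy nb.
  (* By minimality the entries have no constant term, so every monomial that occurs is a proper
     multiple of [m] and has an exponent at least [t]. *)
  right=> F l u; rewrite mxE raddf_sum /= => ne.
  have [k ne'] : exists k, (y F 0 k * D i.+1 k l)@_u <> 0.
    by apply: NNPP => nk; apply: ne; rewrite big1 // => k _; apply: NNPP => ?; apply: nk; exists k.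
  have /yP[eF _ _] : (y F 0 k)@_m <> 0.
    move=> e0; apply: ne'; have -> : y F 0 k = 0.
      apply/mpolyP => v; rewrite mcoeff0; apply: NNPP => ne2.
      by have [_ _ ev] := yP _ _ _ ne2; rewrite ev e0 in ne2.
    by rewrite mul0r mcoeff0.
  move: ne'; rewrite /y eF eqxx mxE; case: eqP => [ek|_]; last by rewrite mul0r mcoeff0.
  rewrite mcoeffXM; case: ifP => // mu ne'.
  have : (u - m)%MM != 0%MM.
    by apply: contra_notN ne' => /eqP ->; apply: D_minimal.
  move=> u0; apply: NNPP => nj; case/eqP: u0; apply/mnmP => j.
  rewrite mnm0E mnmBE mnmE; apply/eqP; rewrite subn_eq0.
  by rewrite -ltnS prednK // ltnNge; apply/negP => tj; apply: nj; exists j.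
have qn : (q < n)%N by rewrite en.
have [iq h'] := syzygy_class_descent hq (ltnW qn) (or_introl qn).
have -> : (n - i.+1 = q - i)%N by rewrite [X in (X - _)%N]en subSS.
by split=> //; apply: leq_ltn_trans qn.
Qed.

(** The generator [e] is taken at the last [i] where the degree bound is attained, and [p = n - i]
    does not depend on [t]. *)
Lemma extremal_class i0 (e0 : 'I_(rk i0.+1)) : dg e0 = r + i0%:Z ->
  exists p, forall t, (0 < t)%N ->
  exists2 a, a + p%:Z = r + (n * t)%:Z & syzygy_class t p 0 a.
Proof.
move=> de0.
pose Q i := exists e : 'I_(rk i.+1), dg e = r + i%:Z.
(* The case t = 1 bounds the length of the resolution, so a last [i] exists. *)
have Qn i : Q i -> (i <= n)%N.
  move=> [e _]; have [|//] := @generator_class 1 i e isT.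
  move=> w; rewrite mxE raddf_sum big1 //= => l _.
  have -> : [multinom 0%N | j < n] = 0%MM :> 'X_{1..n} by [].
  by rewrite rmorphM /= D_minimal mulr0.
have [i [e de] maxi] : exists2 i, Q i & forall j, Q j -> (j <= i)%N.
  pose q i : bool := if excluded_middle_informative (Q i) then true else false.
  have qP i : q i <-> Q i by rewrite /q; case: (excluded_middle_informative (Q i)).
  have exq : exists i, q i by exists i0; apply/qP; exists e0.
  case: (ex_maxnP exq (fun i qi => Qn i (proj1 (qP i) qi))) => i /qP Qi h.
  by exists i => // j /qP /h.
exists (n - i)%N => t t0; exists (dg e + (n * t.-1)%:Z).
  by rewrite de; have := Qn i (ex_intro _ e de); case: t t0 => // t _ /=; lia.
have [|//] := @generator_class t i e t0.
move=> w; rewrite mxE raddf_sum big1 //= => l _.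
(* A nonzero entry here would have positive degree by minimality, so its row would attain the bound
   at [i.+1], against the choice of [i]. *)
have -> : D i.+1 l e = 0; last by rewrite mulr0 mcoeff0.
apply/mpolyP => u; rewrite mcoeff0; apply: NNPP => ne.
have dl := D_graded ne; have bl := dg_bound l.
have [u0|u0] := eqVneq (mdeg u) 0%N.
  by apply: ne; move/eqP: u0; rewrite mdeg_eq0 => /eqP ->; apply: D_minimal.
have /maxi : Q i.+1 by exists l; lia.
by rewrite ltnn.
Qed.

End Resolution.

(** * Regularity as an extremal degree of face cohomology *)

Section Regularity.
Variables (K : fieldType) (n : nat).
Local Notation S := {mpoly K[n]}.
Implicit Types J : S -> Prop.

Definition spanned_by_monomials J : Prop :=
  forall f, J f <-> forall u, f@_u <> 0 -> J 'X_[u].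

(* The resolution of J prolonged by the inclusion of J in S. *)
Definition aug_rank (F : free_sequence K n) i : nat :=
  if i is k.+1 then gr_rank F k else 1%N.
Definition aug_deg (F : free_sequence K n) i : 'I_(aug_rank F i) -> int :=
  match i with 0 => fun=> 0 | k.+1 => @gr_deg _ _ F k end.
Arguments aug_deg : clear implicits.
Definition aug_diff (F : free_sequence K n) i :
    'M[S]_(aug_rank F i.+1, aug_rank F i) :=
  match i with 0 => gr_aug F | k.+1 => gr_diff F k end.

Lemma is_reg_resolution J r : is_reg J r -> exists F,
  [/\ [/\ forall i k l u, (aug_diff F i k l)@_u <> 0 ->
            aug_deg F i.+1 k = aug_deg F i l + (mdeg u)%:Z,
          forall i (v : 'rV_(aug_rank F i.+1)),
            v *m aug_diff F i = 0 <-> exists w, v = w *m aug_diff F i.+1,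
          forall i k l, (aug_diff F i.+1 k l)@_0%MM = 0
        & forall i k, aug_deg F i.+1 k <= r + i%:Z],
      forall f, J f <-> exists v : 'rV_(aug_rank F 1), f = (v *m aug_diff F 0) 0 0
    & exists i k, aug_deg F i.+1 k = r + i%:Z].
Proof.
move=> [F [[[gr0 grS] [Jaug ex0 exS] minF] [i [j [bij rij]]] bd]].
have bettiP a b : betti F a b <> 0%N <-> exists k : 'I_(gr_rank F a), gr_deg k = b.
  split=> [/eqP|[k e]].
    by rewrite -lt0n => /card_gt0P[k]; rewrite inE => /eqP; exists k.
  by apply/eqP; rewrite -lt0n; apply/card_gt0P; exists k; rewrite inE e.
exists F; split=> //; last first.
  have /bettiP[k e] := bij; exists i, k; rewrite [aug_deg _ _ _]e rij; lia.
split.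
- move=> [|a] k l u /eqP; rewrite -mcoeff_msupp; last exact: grS.
  by rewrite (ord1 l) => /gr0 /= ->; rewrite add0r.
- by move=> [|a]; [exact: ex0 | exact: exS].
- exact: minF.
- move=> a k; have := bd a (gr_deg k); rewrite bettiP => /(_ _) h.
  by have := h (ex_intro _ k erefl); rewrite /=; lia.
Qed.

Section Image.
Variables (J : S -> Prop) (q : nat) (A : 'cV[S]_q).
Hypothesis J_mon : spanned_by_monomials J.
Hypothesis JA : forall f, J f <-> exists v : 'rV_q, f = (v *m A) 0 0.
Local Notation faces := (faces (fun u => J 'X_[u])).

Lemma koszul_image_faces t p (b : {set 'I_n} -> 'rV[S]_q) F u :
  koszul t p b -> ((b F *m A) 0 0)@_u <> 0 -> faces t u F /\ #|F|.+1 = p.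
Proof.
move=> kb ne; have [[w e] [sF|b0]] := koszul_entry kb F; last first.
  by move: ne; rewrite b0 mul0mx mxE mcoeff0.
split=> //; move: ne; rewrite e -scalemxAl mxE mcoeffXM; case: ifP => // mu ne.
by split=> //; apply: (proj1 (J_mon ((w *m A) 0 0))) ne; apply/JA; exists w.
Qed.

(** With [koszul_image_faces], this identifies the Koszul cochains of the ideal with polynomial
    cochains supported on faces, so that the two notions of bounding agree. *)
Lemma faces_koszul_image t p (b : {set 'I_n} -> S) :
  (forall F u, (b F)@_u <> 0 -> faces t u F /\ #|F|.+1 = p) ->
  exists y : {set 'I_n} -> 'rV[S]_q,
    koszul t p y /\ forall F, (y F *m A) 0 0 = b F.
Proof.
move=> hb.
have /choice_fun[w hw] F : exists w : 'rV_q, b F = 'X_[mcompl t F] * (w *m A) 0 0.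
  have [g e] : exists g, b F = 'X_[mcompl t F] * g by apply: divX => u /hb[[]].
  have /JA[w ew] : J g; last by exists w; rewrite -ew.
  apply/J_mon => u ne.
  have := hb F (mcompl t F + u)%MM; rewrite e mcoeffXM lem_addr [(_ + u)%MM]addmC addmK.
  by move=> /(_ ne)[[_]]; rewrite addmK.
exists (fun F : {set 'I_n} => if #|F|.+1 == p then 'X_[mcompl t F] *: w F else 0); split.
  exact: koszulX.
move=> F; case: eqP => [_|ne]; first by rewrite -scalemxAl mxE hw.
rewrite mul0mx mxE; apply/mpolyP => u; rewrite mcoeff0.
by apply/esym; apply: NNPP => /hb[].
Qed.

End Image.

(** Multiplied by the monomial of exponent [u], a simplicial class lifts to the generators; above
    the bound [syzygy_vanishing] at [i = 0] makes it a boundary. *)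
Lemma cohomology_le_reg J r t u p : is_reg J r -> spanned_by_monomials J ->
  has_cohomology K (faces (fun v => J 'X_[v]) t u) p ->
  (mdeg u + p)%N%:Z <= r + (n * t)%N%:Z.
Proof.
move=> /is_reg_resolution[F [[gr ex mi bd] JF _]] J_mon [c [sc dc nb]].
rewrite leNgt; apply/negP => lt_r; apply: nb.
have [|y0 [ky0 y0c]] := faces_koszul_image J_mon JF (t := t) (p := p.+1)
    (b := fun F => c F *: 'X_[u]).
  move=> G v; rewrite mcoeffZ mcoeffX; case: eqP => [<-|]; last by rewrite mulr0.
  by rewrite mulr1 => /sc.
pose y G := hproj (aug_deg F) (mdeg u)%:Z (y0 G).
have ky : koszul t p.+1 y by apply: koszul_hproj.
have hy G : has_degree (aug_deg F) (mdeg u)%:Z (y G) by apply: hproj_homog.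
have yc G : (y G *m aug_diff F 0) = \row_l (c G *: 'X_[u]).
  rewrite /y -(hproj_mul gr) hproj_id.
    by apply/rowP => l; rewrite [RHS]mxE (ord1 l) y0c.
  move=> l v; rewrite (ord1 l) y0c mcoeffZ mcoeffX.
  by case: eqP => [-> _|]; rewrite ?mulr0 // add0r.
have dy G : cobd (fun G' => y G' *m aug_diff F 0) G = 0.
  apply/rowP => l; rewrite cobd_entry [RHS]mxE.
  transitivity (cobd c G *: 'X_[u] : S); last by rewrite dc scale0r.
  rewrite /cobd scaler_suml; apply: eq_bigr => j _; rewrite yc mxE.
  by case: odd => //=; rewrite scaleNr.
have [|b [kb yb]] := syzygy_vanishing gr ex bd ky hy dy.
  by rewrite addr0; lia.
exists (fun G => ((b G *m aug_diff F 0) 0 0)@_u); split.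
  by move=> G; apply: (koszul_image_faces J_mon JF).
move=> G; have /rowP/(_ 0)/(congr1 (mcoeff u)) := yb G.
rewrite yc mxE mcoeffZ mcoeffX eqxx mulr1 => ->.
by rewrite cobd_entry (cobd_add (mcoeff u)).
Qed.

(** If every relevant multidegree had trivial cohomology, [multigraded_coboundary] would bound the
    class given by [extremal_class]. *)
Lemma reg_cohomology J r : is_reg J r -> spanned_by_monomials J ->
  exists p, forall t, (0 < t)%N -> exists u,
    has_cohomology K (faces (fun v => J 'X_[v]) t u) p /\
    (mdeg u + p)%N%:Z = r + (n * t)%N%:Z.
Proof.
move=> /is_reg_resolution[F [[gr ex mi bd] JF [i [k dk]]]] J_mon.
have [p hp] := extremal_class gr ex mi bd dk.
exists p => t /hp[a ea [y [ky hy dy nb]]].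
apply: NNPP => nu; apply: nb.
have [|||b [hb cb]] := @multigraded_coboundary K n (fun v => J 'X_[v]) t p
    (fun G => (y G *m aug_diff F 0) 0 0).
- by move=> G u; apply: (koszul_image_faces J_mon JF).
- by move=> G; rewrite -cobd_entry dy mxE.
- move=> G u ne hc; apply: nu; exists u; split=> //.
  have := mul_homog gr (hy G) ne; rewrite /= add0r; lia.
have [z [kz zb]] := faces_koszul_image J_mon JF hb.
exists z; split=> // G; apply/rowP => l; rewrite (ord1 l) cobd_entry cb.
by apply: eq_cobd => G'; rewrite zb.
Qed.

End Regularity.

(** * Dickson's lemma and powers of monomial ideals through exponents *)

Lemma monotone_subsequence (h : nat -> nat) : exists phi : nat -> nat,
  (forall i j, (i < j)%N -> (phi i < phi j)%N) /\
  (forall i j, (i <= j)%N -> (h (phi i) <= h (phi j))%N).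
Proof.
(* Beyond any index there is one where [h] is minimal on its tail; [phi] runs through such
   indices. *)
have /choice_fun[M hM] a : exists b, (a <= b)%N /\ forall c, (b <= c)%N -> (h b <= h c)%N.
  have [k] := ubnP (h a); elim: k a => // k IH a ak.
  case: (classic (exists c, (a <= c)%N /\ (h c < h a)%N)) => [[c [ac hc]]|no].
    have [b [cb hb]] := IH c (leq_trans hc ak).
    by exists b; split=> //; exact: leq_trans ac cb.
  exists a; split=> // c ac; rewrite leqNgt; apply/negP => hc; apply: no.
  by exists c.
pose phi := fix phi i := if i is i'.+1 then M (phi i').+1 else M 0%N.
have phiS i : (phi i < phi i.+1)%N by rewrite /=; case: (hM (phi i).+1).
have minphi i c : (phi i <= c)%N -> (h (phi i) <= h c)%N.
  by case: i => [|i] /=; [case: (hM 0%N) => _ | case: (hM (phi i).+1) => _]; apply.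
have lt_phi i j : (i < j)%N -> (phi i < phi j)%N.
  elim: j => // j IH; rewrite ltnS leq_eqVlt => /orP[/eqP <- //|/IH ij].
  exact: ltn_trans ij (phiS j).
exists phi; split=> // i j; rewrite leq_eqVlt => /orP[/eqP -> //|/lt_phi/ltnW].
exact: minphi.
Qed.

Lemma monotone_subsequences d (f : nat -> nat -> nat) : exists phi : nat -> nat,
  (forall i j, (i < j)%N -> (phi i < phi j)%N) /\
  (forall k i j, (k < d)%N -> (i <= j)%N -> (f (phi i) k <= f (phi j) k)%N).
Proof.
elim: d => [|d [phi [inc mon]]]; first by exists id.
have [psi [inc' mon']] := monotone_subsequence (fun i => f (phi i) d).
exists (phi \o psi); split=> [i j ij|k i j]; first by apply/inc/inc'.
rewrite ltnS leq_eqVlt => /orP[/eqP -> ij|kd]; first exact: mon'.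
rewrite leq_eqVlt => /orP[/eqP -> //|/inc'/ltnW]; exact: mon.
Qed.

Section Dickson.
Variable n : nat.
Implicit Types (P : 'X_{1..n} -> Prop) (u v : 'X_{1..n}).

(** Otherwise one keeps choosing elements of [P] above no earlier one, and a subsequence monotone in
    all coordinates contradicts this choice. *)
Lemma dickson P : exists B : seq 'X_{1..n},
  (forall b, b \in B -> P b) /\ (forall u, P u -> exists2 b, b \in B & (b <= u)%MM).
Proof.
apply: NNPP => nB.
have /choice_fun[g hg] (B : seq 'X_{1..n}) : exists u, (forall b, b \in B -> P b) ->
    P u /\ forall b, b \in B -> ~ (b <= u)%MM.
  case: (classic (exists u, P u /\ forall b, b \in B -> ~ (b <= u)%MM)).
    by move=> [u hu]; exists u.
  move=> no; exists 0%MM => PB; case: nB; exists B; split=> // u Pu.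
  by apply: NNPP => nb; apply: no; exists u; split=> // b bB bu; apply: nb; exists b.
pose s := fix s k := if k is k'.+1 then g (s k') :: s k' else [::].
have sP k : forall b, b \in s k -> P b.
  elim: k => // k IH b; rewrite inE => /orP[/eqP ->|/IH //].
  by case: (hg (s k) IH).
have mem_s i j : (i < j)%N -> g (s i) \in s j.
  elim: j => // j IH; rewrite ltnS leq_eqVlt inE => /orP[/eqP ->|/IH ->]; rewrite ?eqxx ?orbT //.
pose f i k := if insub k is Some j then g (s i) j else 0%N.
have [phi [inc mon]] := monotone_subsequences n f.
have [_ /(_ _ (mem_s _ _ (inc 0%N 1%N isT)))] := hg (s (phi 1%N)) (sP _).
apply; apply/mnm_lepP => j; have := mon j 0%N 1%N (ltn_ord j) isT.
by rewrite /f valK.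
Qed.

(* [mpow P k] is the set of exponents of the k-th power of the ideal
   whose monomials are the [x^u] with [P u]. *)
Fixpoint mpow P k u : Prop :=
  if k is k'.+1 then exists a b, [/\ P a, mpow P k' b & u = (a + b)%MM] else True.

Definition upset P : Prop := forall u v, P u -> (u <= v)%MM -> P v.

(** The exponent form of integral closure for monomial ideals, justified by [integral_closureX]. *)
Definition mclosure P u : Prop := exists2 l, (0 < l)%N & mpow P l (u *+ l)%MM.

Lemma mpow_up P k : upset P -> upset (mpow P k).
Proof.
move=> uP; elim: k => // k IH u v [a [b [Pa Pb ->]]] uv.
exists a, (b + (v - (a + b)))%MM; split=> //; first by apply: IH Pb (lem_addr _ _).
by rewrite addmA addmC submK.
Qed.

Lemma mpow_add P i j u : upset P ->
  mpow P (i + j) u <-> exists a b, [/\ mpow P i a, mpow P j b & u = (a + b)%MM].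
Proof.
move=> uP; elim: i u => [|i IH] u; split.
- by move=> h; exists 0%MM, u; rewrite add0m.
- by move=> [a [b [_ Pb ->]]]; apply: mpow_up Pb (lem_addl _ _).
- move=> [a [b [Pa /IH[a' [b' [Pa' Pb' ->]]] ->]]].
  by exists (a + a')%MM, b'; split=> //; [exists a, a' | rewrite addmA].
- move=> [_ [b [[a [a' [Pa Pa' ->]]] Pb ->]]].
  by exists a, (a' + b)%MM; split=> //; [apply/IH; exists a', b | rewrite addmA].
Qed.

Lemma mpow_le P i j u : upset P -> (i <= j)%N -> mpow P j u -> mpow P i u.
Proof.
move=> uP /subnKC <- /(mpow_add _ _ _ uP)[a [b [Pa _ ->]]].
exact: mpow_up Pa (lem_addr _ _).
Qed.

Lemma mpow_mul P s l u : upset P -> mpow (mpow P s) l u <-> mpow P (s * l) u.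
Proof.
move=> uP; elim: l u => [|l IH] u; first by rewrite muln0.
rewrite mulnS; split=> [[a [b [Pa /IH Pb ->]]]|/(mpow_add _ _ _ uP)[a [b [Pa /IH Pb ->]]]].
  by apply/mpow_add => //; exists a, b.
by exists a, b.
Qed.

Lemma mpow_muln P k l u : upset P -> mpow P k u -> mpow P (k * l) (u *+ l)%MM.
Proof.
move=> uP h; apply/mpow_mul => //; elim: l => // l IH.
by exists u, (u *+ l)%MM; split=> //; rewrite mulmS.
Qed.

Lemma mclosure_up P : upset P -> upset (mclosure P).
Proof.
move=> uP u v [l l0 Pl] uv; exists l => //; apply: mpow_up Pl _ => //.
by apply/mnm_lepP => j; rewrite !mulmnE leq_mul2r; move/mnm_lepP: uv => ->; rewrite orbT.
Qed.

Lemma mclosure_scale P s m u : upset P -> (0 < m)%N ->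
  mclosure (mpow P s) u <-> mclosure (mpow P (s * m)) (u *+ m)%MM.
Proof.
have mulmA v a b : (v *+ a *+ b = v *+ (a * b))%MM.
  by apply/mnmP => j; rewrite !mulmnE mulnA.
move=> uP m0; split=> [[l l0 /(mpow_mul _ _ _ uP) h]|[l l0 /(mpow_mul _ _ _ uP) h]].
  exists l => //; apply/mpow_mul => //.
  have -> : (s * m * l = s * l * m)%N by lia.
  have -> : (u *+ m *+ l = u *+ l *+ m)%MM by rewrite !mulmA mulnC.
  exact: mpow_muln.
exists (m * l)%N; first by rewrite muln_gt0 m0.
by apply/mpow_mul => //; rewrite mulnA -mulmA.
Qed.

(** Together with [multiplicities_mpow], this turns membership in a power into linear inequalities
    on the multiplicities of finitely many generators, which can then be subtracted. *)
Lemma mpow_multiplicities P (B : seq 'X_{1..n}) k u :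
  (forall v, P v -> exists2 b, b \in B & (b <= v)%MM) -> mpow P k u ->
  exists c : nat -> nat, (\sum_(i < size B) c i)%N = k /\
    forall j, (\sum_(i < size B) nth 0%MM B i j * c i <= u j)%N.
Proof.
move=> hB; elim: k u => [|k IH] u.
  by move=> _; exists (fun=> 0%N); split=> [|j]; rewrite big1 // => i _; rewrite muln0.
move=> [a [b [/hB[v vB va] /IH[c [ck hc]] ->]]].
have iB : (index v B < size B)%N by rewrite index_mem.
exists (fun i => (i == index v B) + c i)%N; split=> [|j].
  rewrite big_split /= ck (bigD1 (Ordinal iB)) //= eqxx big1 // => i.
  by rewrite -(inj_eq val_inj) /= => /negbTE ->.
under eq_bigr do rewrite mulnDr.
rewrite big_split mnmDE leq_add //= (bigD1 (Ordinal iB)) //= eqxx muln1 nth_index //.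
rewrite big1 ?addn0 => [|i]; first by move/mnm_lepP: va => ->.
by rewrite -(inj_eq val_inj) /= => /negbTE ->; rewrite muln0.
Qed.

Lemma multiplicities_mpow P (B : seq 'X_{1..n}) k u (c : nat -> nat) :
  (forall b, b \in B -> P b) -> (\sum_(i < size B) c i)%N = k ->
  (forall j, (\sum_(i < size B) nth 0%MM B i j * c i <= u j)%N) -> mpow P k u.
Proof.
move=> PB; elim: k u c => // k IH u c ck hc.
have [i ci] : exists i : 'I_(size B), (0 < c i)%N.
  apply: NNPP => no; move: ck; rewrite big1 // => i _.
  by apply/eqP; rewrite -leqn0 leqNgt; apply/negP => ci; apply: no; exists i.
have cE (l : 'I_(size B)) : c l = ((l == i) + (c l - (l == i)))%N.
  by rewrite subnKC //; case: eqP => // ->.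
have hu : (nth 0%MM B i <= u)%MM.
  apply/mnm_lepP => j; apply: leq_trans (hc j); rewrite (bigD1 i) //=.
  by apply: leq_trans (leq_addr _ _); rewrite leq_pmulr.
exists (nth 0%MM B i), (u - nth 0%MM B i)%MM; split.
- by apply/PB/mem_nth.
- apply: (IH _ (fun l => c l - (l == i))%N).
    apply/eqP; rewrite -(eqn_add2l 1) [(1 + k)%N]add1n -ck; apply/eqP.
    under [RHS]eq_bigr do rewrite cE.
    rewrite big_split /=; congr (_ + _)%N.
    by rewrite (bigD1 i) //= eqxx big1 // => l /negbTE ->.
  move=> j; rewrite mnmBE -(leq_add2l (nth 0%MM B i j)) subnKC; last by move/mnm_lepP: hu.
  apply: leq_trans (hc j); under [X in (_ <= X)%N]eq_bigr do rewrite cE mulnDr.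
  rewrite big_split leq_add2r /= (bigD1 i) //= eqxx muln1 leq_addr //.
- by rewrite addmC submK.
Qed.

(** Two exponents [a < b] are found along which multiplicities and slacks both grow. Subtracting the
    two systems of inequalities cancels [N] and leaves membership of [b - a] times [u] in the power
    [b - a]. *)
Lemma mclosure_asymptotic P N u : upset P ->
  (forall k, mpow P k (u *+ (k + N))%MM) -> mclosure P u.
Proof.
move=> uP hu; have [B [PB BP]] := dickson P.
have /choice_fun[c hc] k := mpow_multiplicities BP (hu k).
pose d := size B.
pose tot k j := (\sum_(i < d) nth 0%MM B i j * c k i)%N.
(* The first [d] coordinates are the multiplicities, the next [n] the slacks in the inequalities. *)
pose f k i := if (i < d)%N then c k i
  else if insub (i - d)%N is Some j then (u j * (k + N) - tot k j)%N else 0%N.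
have [phi [inc mon]] := monotone_subsequences (d + n) f.
set a := phi 0%N; set b := phi 1%N.
have ab : (a < b)%N := inc 0%N 1%N isT.
have cab (i : 'I_d) : (c a i <= c b i)%N.
  by have := mon i 0%N 1%N (ltn_addr _ (ltn_ord i)) isT; rewrite /f ltn_ord.
exists (b - a)%N; first by rewrite subn_gt0.
apply: (multiplicities_mpow (c := fun i => (c b i - c a i)%N) PB).
  by rewrite sumnB => [|i _]; [rewrite (proj1 (hc a)) (proj1 (hc b)) | exact: cab].
move=> j.
have -> : (\sum_(i < size B) nth 0%MM B i j * (c b i - c a i) = tot b j - tot a j)%N.
  rewrite /tot -sumnB => [|i _]; last by rewrite leq_mul2l cab orbT.
  by apply: eq_bigr => i _; rewrite mulnBr.
have := mon (d + j)%N 0%N 1%N; rewrite ltn_add2l ltn_ord => /(_ isT isT).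
rewrite /f ltnNge leq_addr /= addKn valK -/a -/b.
have [_ /(_ j)] := hc a; have [_ /(_ j)] := hc b; rewrite -/(tot a j) -/(tot b j).
rewrite !mulmnE; nia.
Qed.

End Dickson.

(** * Integral closures of monomial ideals *)

Section IntegralClosure.
Variables (K : fieldType) (n : nat).
Local Notation S := {mpoly K[n]}.
Implicit Types (I J : S -> Prop) (P Q : 'X_{1..n} -> Prop) (f g : S).

Definition in_span P f : Prop := forall u, f@_u <> 0 -> P u.

Lemma in_span_sum P (T : finType) (F : T -> S) :
  (forall i, in_span P (F i)) -> in_span P (\sum_i F i).
Proof.
move=> PF u ne; apply: NNPP => nP; apply: ne; rewrite raddf_sum big1 //= => i _.
by apply: NNPP => /PF.
Qed.

Lemma in_spanN P f : in_span P f -> in_span P (- f).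
Proof. by move=> Pf u; rewrite mcoeffN => ne; apply: Pf => e; apply: ne; rewrite e oppr0. Qed.

Lemma in_spanX P u : P u -> in_span P 'X_[u].
Proof. by move=> Pu v; rewrite mcoeffX; case: eqP => [<-|_ /eqP]; rewrite ?eqxx. Qed.

Lemma mcoeffM_neq0 f g u : (f * g)@_u <> 0 ->
  exists a b, [/\ f@_a <> 0, g@_b <> 0 & u = (a + b)%MM].
Proof.
move=> ne; apply: NNPP => no; apply: ne; rewrite mcoeffM big1 // => -[a b] /eqP e /=.
case: (eqVneq f@_a 0) => [->|/eqP fa]; first by rewrite mul0r.
case: (eqVneq g@_b 0) => [->|/eqP gb]; first by rewrite mulr0.
by case: no; exists a, b; split.
Qed.

Lemma ideal_gen_in_span P (G : S -> Prop) f : upset P ->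
  (forall g, G g -> in_span P g) -> ideal_gen G f -> in_span P f.
Proof.
move=> uP PG [r [a [g [Gg ->]]]]; apply: in_span_sum => k u.
by move=> /mcoeffM_neq0[v [w [_ /(PG _ (Gg k)) Pw ->]]]; apply: uP Pw (lem_addl _ _).
Qed.

Lemma in_span_ideal_gen P (G : S -> Prop) f :
  (forall u, P u -> exists g h, G g /\ 'X_[u] = h * g) ->
  in_span P f -> ideal_gen G f.
Proof.
move=> PG Pf.
have /choice_fun[p hp] (k : 'I_(size (msupp f))) : exists p : S * S,
    G p.1 /\ 'X_[tnth (in_tuple (msupp f)) k] = p.2 * p.1.
  have /PG[g [h gh]] : P (tnth (in_tuple (msupp f)) k); last by exists (g, h).
  by apply/Pf/eqP; rewrite -mcoeff_msupp mem_tnth.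
exists (size (msupp f)), (fun k => f@_(tnth (in_tuple (msupp f)) k) *: (p k).2), (fun k => (p k).1).
split=> [k|]; first by case: (hp k).
rewrite [LHS]mpolyE big_tnth; apply: eq_bigr => k _.
by rewrite -scalerAl; case: (hp k) => _ <-.
Qed.

Lemma monomial_ideal_span I : monomial_ideal I ->
  exists P, upset P /\ forall f, I f <-> in_span P f.
Proof.
move=> [A IA]; exists (fun u => exists2 a, A a & (a <= u)%MM).
have uP : upset (fun u => exists2 a, A a & (a <= u)%MM).
  by move=> u v [a Aa au] uv; exists a => //; apply: lepm_trans uv.
split=> // f; split=> [/IA|h]; last first.
  apply/IA; apply: in_span_ideal_gen h => u [a Aa au].
  by exists 'X_[a], 'X_[u - a]; split; [exists a | rewrite -mpolyXD submK].
apply: ideal_gen_in_span => // g [a Aa ->]; apply: in_spanX.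
by exists a => //; apply: lepm_refl.
Qed.

Lemma ideal_exp_span I P k : upset P -> (forall f, I f <-> in_span P f) ->
  forall f, ideal_exp I k f <-> in_span (mpow P k) f.
Proof.
move=> uP IP; elim: k => [|k IH] f; first by split.
split.
  apply: ideal_gen_in_span; first exact: (@mpow_up _ P k.+1 uP).
  move=> _ [g [h [/IP Ig /IH Jh ->]]] u /mcoeffM_neq0[a [b [/Ig Pa /Jh Pb ->]]].
  by exists a, b.
apply: in_span_ideal_gen => u [a [b [Pa Pb ->]]].
exists 'X_[a + b], 1; rewrite mul1r; split=> //.
exists 'X_[a], 'X_[b]; split; last by rewrite mpolyXD.
  by apply/IP; apply: in_spanX.
by apply/IH; apply: in_spanX.
Qed.

Section Closure.
Variables (J : S -> Prop) (P : 'X_{1..n} -> Prop).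
Hypothesis P_up : upset P.
Hypothesis JP : forall f, J f <-> in_span P f.

(** The monomial is a root of a pure equation: its l-th power minus itself, the constant term lying
    in the l-th power of [J]. *)
Lemma mclosure_integral u : mclosure P u -> integral_closure J 'X_[u].
Proof.
move=> [[//|l] _ Pl].
exists l.+1, (fun i : 'I_l.+1 => if i == ord_max then - 'X_[u *+ l.+1] else 0).
split=> // [i|].
  apply/(ideal_exp_span _ P_up JP); case: eqP => [->|_]; last by move=> v; rewrite mcoeff0.
  by apply: in_spanN; apply: in_spanX.
rewrite (bigD1 ord_max) //= eqxx subnn expr0 mulr1 big1 => [|i /negbTE ->].
  by rewrite addr0 mpolyXn subrr.
by rewrite mul0r.
Qed.

(** The power [j + k - 1] of [f] lies in the j-th power of [J]. Leading monomials multiply over a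
    field, so [mclosure_asymptotic] applies with [N = k - 1]. *)
Lemma integral_closure_mlead f : f <> 0 -> integral_closure J f ->
  mclosure P (mlead f).
Proof.
move=> f0 [k [c [k0 Jc eqn]]].
have Pc (i : 'I_k) : in_span (mpow P i.+1) (c i) by apply/(ideal_exp_span _ P_up JP).
(* Reducing by the equation trades [k - 1] powers for membership. *)
have hf j : in_span (mpow P j) (f ^+ (j + k.-1)).
  have [N] := ubnP j; elim: N j => // N IH [|j]; first by [].
  rewrite ltnS => jN.
  have -> : f ^+ (j.+1 + k.-1) = - \sum_(i < k) c i * f ^+ (j + (k - i.+1)).
    have -> : (j.+1 + k.-1 = j + k)%N by lia.
    rewrite exprD; move/eqP: eqn; rewrite addr_eq0 => /eqP ->.
    rewrite mulrN mulr_sumr; congr (- _); apply: eq_bigr => i _.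
    by rewrite mulrCA exprD.
  apply: in_spanN; apply: in_span_sum => i u /mcoeffM_neq0[a [b [/(Pc i) Pa fb ->]]].
  case: (leqP j i) => ij.
    by apply: mpow_le (mpow_up P_up Pa (lem_addr _ _)).
  have Pb : mpow P (j - i) b.
    apply: (IH (j - i)%N); first by lia.
    by have -> : (j - i + k.-1 = j + (k - i.+1))%N by have := ltn_ord i; lia.
  have -> : j.+1 = (i.+1 + (j - i))%N by lia.
  by apply/mpow_add => //; exists a, b.
apply: (@mclosure_asymptotic _ _ k.-1) => // j; apply: (hf j).
by rewrite mleadcX; apply/eqP; rewrite expf_neq0 // mleadc_eq0; apply/eqP.
Qed.

Lemma integral_closureX u : integral_closure J 'X_[u] <-> mclosure P u.
Proof.
split=> [h|]; last exact: mclosure_integral.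
rewrite -(mleadXm K u); apply: integral_closure_mlead h; apply/eqP.
by rewrite -msize_poly_eq0 msizeX.
Qed.

(** As the image of a matrix, the closure is stable under sums and scalars. It contains the leading
    monomial of each nonzero member, so terms can be stripped off one by one. *)
Lemma integral_closure_spanned q (A : 'cV[S]_q) :
  (forall f, integral_closure J f <-> exists v : 'rV_q, f = (v *m A) 0 0) ->
  spanned_by_monomials (integral_closure J).
Proof.
move=> clA.
have clD f g : integral_closure J f -> integral_closure J g -> integral_closure J (f + g).
  move=> /clA[v ->] /clA[w ->]; apply/clA; exists (v + w).
  by rewrite mulmxDl [RHS]mxE.
have cl0 : integral_closure J 0 by apply/clA; exists 0; rewrite mul0mx mxE.
have clZ a u : integral_closure J 'X_[u] -> integral_closure J (a *: 'X_[u]).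
  move=> /clA[v e]; apply/clA; exists (a%:MP *: v).
  by rewrite -scalemxAl [RHS]mxE -e mul_mpolyC.
move=> f; split=> [|h]; last first.
  rewrite (mpolyE f) big_seq; apply: (big_ind (integral_closure J) cl0 clD) => u.
  by rewrite mcoeff_msupp => /eqP /h; apply: clZ.
have [N] := ubnP (size (msupp f)); elim: N f => [f|N IH f].
  move=> lt0; discriminate lt0.
rewrite ltnS => fN clf u fu.
have f0 : f <> 0 by move=> e; apply: fu; rewrite e mcoeff0.
have clm : integral_closure J 'X_[mlead f].
  by apply: mclosure_integral; apply: integral_closure_mlead.
case: (eqVneq u (mlead f)) => [-> //|um].
have f0' : f != 0 by apply/eqP.
apply: (IH (f - f@_(mlead f) *: 'X_[mlead f])).
- rewrite (perm_size (msupp_rem _ _)) size_rem ?mlead_supp //.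
  by move: fN; have := mlead_supp f0'; case: (msupp f).
- by rewrite -scaleNr; apply: clD clf _; apply: clZ.
- by rewrite mcoeffB mcoeffZ mcoeffX eq_sym (negbTE um) mulr0 subr0.
Qed.

End Closure.
End IntegralClosure.

(** * Stability of faces, and multidegrees attaining the regularity *)

Section Faces.
Variable n : nat.
Implicit Types (Q P : 'X_{1..n} -> Prop) (u v : 'X_{1..n}) (F : {set 'I_n}).

(* Membership in [Q] does not see exponents beyond [g]. *)
Definition stable_from Q g : Prop :=
  forall u v, Q u -> (forall j, (u j <= v j)%N \/ (g <= v j)%N) -> Q v.

Lemma upset_stable Q : upset Q -> exists g, stable_from Q g.
Proof.
move=> uQ; have [B [BQ QB]] := dickson Q.
exists (\max_(b <- B) mdeg b)%N => u v /QB[b bB /mnm_lepP bu] uv.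
apply: uQ (BQ b bB) _; apply/mnm_lepP => j; case: (uv j); first exact: leq_trans.
apply: leq_trans; apply: (@leq_trans (mdeg b)); last exact: leq_bigmax_seq.
by rewrite mdegE (bigD1 j) //= leq_addr.
Qed.

Lemma facesE Q t u F : faces Q t u F <->
  (forall j, j \notin F -> (t <= u j)%N) /\
  Q [multinom (if j \in F then u j else u j - t)%N | j < n].
Proof.
have -> : [multinom (if j \in F then u j else u j - t)%N | j < n] = (u - mcompl t F)%MM.
  by apply/mnmP => j; rewrite mnmE mnmBE mcomplE; case: ifP; rewrite ?subn0.
by split=> [[/mcomplP]|[/mcomplP]].
Qed.

Lemma faces_stable Q g t u u' F : stable_from Q g ->
  (forall j, (t <= u j)%N -> (t <= u' j)%N) ->
  (forall j, (u j <= u' j)%N \/ (g <= u' j)%N) ->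
  (forall j, (t <= u j)%N -> (u j - t <= u' j - t)%N \/ (g <= u' j - t)%N) ->
  faces Q t u F -> faces Q t u' F.
Proof.
move=> sQ h1 h2 h3 /facesE[tu Qu]; apply/facesE; split=> [j /tu /h1 //|].
apply: sQ Qu _ => j; rewrite !mnmE; case: (boolP (j \in F)) => [_|/tu /h3]; first exact: h2.
by [].
Qed.

Variable K : fieldType.

Lemma normalized_multidegree Q g t r p u : stable_from Q g ->
  (n * g + n + 1 < t)%N -> 0 <= r ->
  (forall v, has_cohomology K (faces Q t v) p -> (mdeg v + p)%N%:Z <= r + (n * t)%N%:Z) ->
  has_cohomology K (faces Q t u) p -> (mdeg u + p)%N%:Z = r + (n * t)%N%:Z ->
  forall j, (t.-1 <= u j)%N.
Proof.
move=> sQ tg r0 Hle Hu Eu k.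
(* Beyond [t + g] neither inverting the variable [j] nor clearing its denominator affects
   membership, so [j] would be an apex. *)
have ub j : (u j < t + g)%N.
  rewrite ltnNge; apply/negP => tgu; move: Hu; apply: (apex_no_cohomology (a := j)).
  move=> F /facesE[h Qh]; apply/facesE; split=> [i iF|].
    case: (eqVneq i j) => [->|ij]; first by apply: leq_trans tgu; rewrite leq_addr.
    by apply: h; rewrite !inE negb_or ij.
  apply: sQ Qh _ => i; rewrite !mnmE !inE; case: (eqVneq i j) => [->|_]; last by left.
  by right; case: ifP => _; lia.
rewrite leqNgt; apply/negP => ukt.
have pn := has_cohomology_le Hu.
(* If [g <= u k < t - 1], raising [u k] by one changes no face and contradicts maximality. If
   [u k < g], the bounds on the other entries make the total degree too small for a [t] this
   large. *)
case: (leqP g (u k)) => gk.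
  have /Hle : has_cohomology K (faces Q t (u + U_(k))%MM) p.
    have uE j : (u + U_(k))%MM j = (u j + (k == j))%N by rewrite mnmDE mnm1E.
    apply: has_cohomology_ext Hu => F; split; apply: (faces_stable sQ) => j;
      rewrite ?uE; case: eqP => [<-|_] /=; rewrite ?addn0; try lia.
  by rewrite mdegD mdeg1; lia.
have : (mdeg u <= g + n.-1 * (t + g))%N.
  rewrite mdegE (bigD1 k) //= leq_add ?(ltnW gk) //.
  apply: (@leq_trans (\sum_(i < n | i != k) (t + g))).
    by apply: leq_sum => j _; rewrite ltnW.
  by rewrite sum_nat_const cardC1 card_ord.
have n0 : (0 < n)%N by apply: leq_ltn_trans (ltn_ord k).
have nE x : (n * x = n.-1 * x + x)%N by rewrite -[X in (X * x = _)%N](prednK n0) mulSn addnC.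
by move: tg Eu; rewrite !nE mulnDr; lia.
Qed.

End Faces.

(** * Minimal generators, [gamma], and faces of small multidegrees *)

Section Monomials.
Variables (K : fieldType) (n : nat) (I : {mpoly K[n]} -> Prop)
  (P : 'X_{1..n} -> Prop).
Hypothesis P_up : upset P.
Hypothesis IP : forall f, I f <-> in_span P f.

Lemma mem_idealX u : I 'X_[u] <-> P u.
Proof.
split=> [/IP h|Pu]; last by apply/IP; apply: in_spanX.
by apply: h; rewrite mcoeffX eqxx; apply/eqP; rewrite oner_eq0.
Qed.

Lemma min_gen_below u : P u -> exists2 v, min_gen I v & (v <= u)%MM.
Proof.
have [k] := ubnP (mdeg u); elim: k u => // k IH u uk Pu.
case: (classic (exists v, [/\ P v, (v <= u)%MM & v <> u])) => [[v [Pv vu ne]]|no].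
  have lt : (mdeg v < mdeg u)%N.
    rewrite -(submK vu) mdegD addnC -[X in (X < _)%N]addn0 ltn_add2l lt0n mdeg_eq0.
    by apply/eqP => e; apply: ne; rewrite -(submK vu) e add0m.
  have [w mw wv] := IH v (leq_trans lt uk) Pv.
  by exists w => //; apply: lepm_trans vu.
exists u; last exact: lepm_refl.
split=> [|v /mem_idealX Pv vu]; first exact/mem_idealX.
by apply: NNPP => ne; apply: no; exists v.
Qed.

Lemma is_gamma_gamma : (exists u, P u) -> ~ P 0%MM -> is_gamma I (gamma I).
Proof.
move=> [u /min_gen_below[v mv _]] P0; apply: epsilon_spec.
pose V x := exists w (j : 'I_n), [/\ min_gen I w, (0 < w j)%N & x = w j].
have [x Vx] : exists x, V x.
  have [j vj] : exists j, (0 < v j)%N.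
    apply: NNPP => no; apply: P0; have -> : 0%MM = v; last by case: mv => /mem_idealX.
    apply/mnmP => j; rewrite mnm0E; apply/esym/eqP; rewrite -leqn0 leqNgt.
    by apply/negP => vj; apply: no; exists j.
  by exists (v j), v, j.
have [k] := ubnP x; elim: k x Vx => // k IH x Vx xk.
case: (classic (exists2 y, V y & (y < x)%N)) => [[y Vy yx]|no].
  exact: IH Vy (leq_trans yx xk).
exists x; split=> // w j mw wj; rewrite leqNgt; apply/negP => lt; apply: no.
by exists (w j) => //; exists w, j.
Qed.

Lemma mpow_degree_off (F : {set 'I_n}) N x d :
  (forall w, P w -> (d <= \sum_(j | j \notin F) w j)%N) ->
  mpow P N x -> (d * N <= \sum_(j | j \notin F) x j)%N.
Proof.
move=> hd; elim: N x => [|N IH] x; first by rewrite muln0.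
move=> [a [b [/hd ha /IH hb ->]]]; rewrite mulnS.
under [X in (_ <= X)%N]eq_bigr do rewrite mnmDE.
by rewrite big_split leq_add.
Qed.

(* In this range the family is that of the localizations where [I] becomes the
   unit ideal; in particular it does not depend on [k]. *)
Lemma faces_small_multidegree k t g (u : 'X_{1..n}) (F : {set 'I_n}) : is_gamma I (gamma I) ->
  stable_from (mclosure (mpow P k)) g -> (g < t)%N ->
  (forall j, (t.-1 <= u j)%N) -> (\sum_j (u j - t) < gamma I * k)%N ->
  faces (mclosure (mpow P k)) t u F <->
    (forall j, j \notin F -> (t <= u j)%N) /\
    exists2 w, P w & forall j, j \notin F -> w j = 0%N.
Proof.
move=> [_ gam] sQ gt ut small; rewrite facesE; split=> [[h [l l0]]|[h [w Pw w0]]].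
  move=> /(mpow_mul _ _ _ P_up) hl; split=> //; apply: NNPP => no.
  (* Every minimal generator involves a variable off [F], with exponent at least [gamma I]; products
     then have too large a degree off [F]. *)
  have hd w : P w -> (gamma I <= \sum_(j | j \notin F) w j)%N.
    move=> /min_gen_below[v mv /mnm_lepP vw].
    have [j [jF vj]] : exists j, j \notin F /\ (0 < v j)%N.
      apply: NNPP => no'; apply: no; exists v; first by case: mv => /mem_idealX.
      move=> j jF; apply/eqP; rewrite -leqn0 leqNgt; apply/negP => vj.
      by apply: no'; exists j.
    rewrite (bigD1 j) //=; apply: leq_trans (leq_addr _ _).
    exact: leq_trans (gam v j mv vj) (vw j).
  have := mpow_degree_off hd hl; rewrite leqNgt => /negP; apply.
  apply: (@leq_ltn_trans (\sum_(j < n) (u j - t) * l)).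
    rewrite [X in (_ <= X)%N](bigID (fun j => j \notin F)) /=.
    apply: leq_trans (leq_addr _ _); apply: leq_sum => j jF.
    by rewrite mulmnE mnmE (negbTE jF).
  by rewrite -big_distrl /= mulnA ltn_pmul2r.
(* Off [F] the k-th power of [w] has exponent zero; on [F] the target exponents are at least
   [t - 1], beyond the threshold [g]. *)
split=> //; apply: sQ (w *+ k)%MM _ _ _ => [|j].
  exists 1%N => //; exists (w *+ k)%MM, 0%MM; rewrite mulm1n addm0; split=> //.
  rewrite -[k in mpow _ k]mul1n; apply: mpow_muln => //.
  by exists w, 0%MM; rewrite addm0.
rewrite mnmE mulmnE; case: (boolP (j \in F)) => [_|/w0 ->]; last by left.
by right; apply: leq_trans (ut j); case: (t) gt.
Qed.

End Monomials.

(** * Regularity of the integral closure of a power *)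

Section ClosureRegularity.
Variables (K : fieldType) (n : nat) (I : {mpoly K[n]} -> Prop)
  (P : 'X_{1..n} -> Prop).
Hypothesis P_up : upset P.
Hypothesis IP : forall f, I f <-> in_span P f.
Variables (k : nat) (r : int).
Hypothesis reg_k : is_reg (integral_closure (ideal_exp I k)) r.
Local Notation J := (integral_closure (ideal_exp I k)).
Local Notation Q := (mclosure (mpow P k)).

Let Pk_up : upset (mpow P k) := @mpow_up _ P k P_up.
Let JX u : J 'X_[u] <-> Q u := integral_closureX Pk_up (ideal_exp_span k P_up IP) u.

Lemma closure_spanned : spanned_by_monomials J.
Proof.
have [F [_ JF _]] := is_reg_resolution reg_k.
exact: (integral_closure_spanned Pk_up (ideal_exp_span k P_up IP) JF).
Qed.

Lemma facesJ t u F : faces (fun v => J 'X_[v]) t u F <-> faces Q t u F.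
Proof. by split=> -[tu /JX Qu]. Qed.

Lemma closure_cohomology_le t u p : has_cohomology K (faces Q t u) p ->
  (mdeg u + p)%N%:Z <= r + (n * t)%N%:Z.
Proof.
move=> h; apply: (cohomology_le_reg reg_k closure_spanned).
by apply: has_cohomology_ext h => F; split=> /facesJ.
Qed.

Lemma closure_cohomology : exists p, forall t, (0 < t)%N -> exists u,
  has_cohomology K (faces Q t u) p /\ (mdeg u + p)%N%:Z = r + (n * t)%N%:Z.
Proof.
have [p hp] := reg_cohomology reg_k closure_spanned.
exists p => t /hp[u [hu eu]]; exists u; split=> //.
by apply: has_cohomology_ext hu => F; split=> /facesJ.
Qed.

(** A nonzero entry of the augmentation contains a monomial of the ideal, of positive degree because
    the ideal is proper, and that degree is at most [r]. *)
Lemma closure_reg_gt0 : (exists u, Q u) -> ~ Q 0%MM -> 0 < r.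
Proof.
move=> [u /JX]; have [F [[gr _ _ bd] JF _]] := is_reg_resolution reg_k.
move=> /JF[v ev] Q0.
have [l [w Aw]] : exists l w, (aug_diff F 0 l 0)@_w <> 0.
  apply: NNPP => no; have := mcoeffX K u u; rewrite ev eqxx mxE raddf_sum big1 /=.
    by move/esym/eqP; rewrite oner_eq0.
  move=> l _; have -> : aug_diff F 0 l 0 = 0.
    by apply/mpolyP => w; rewrite mcoeff0; apply: NNPP => ne; apply: no; exists l, w.
  by rewrite mulr0 mcoeff0.
have Qw : Q w.
  apply/JX; apply: (proj1 (closure_spanned (aug_diff F 0 l 0))) Aw.
  apply/JF; exists (delta_mx 0 l); by rewrite -rowE mxE.
have : mdeg w != 0%N.
  by rewrite mdeg_eq0; apply/eqP => w0; apply: Q0; rewrite -w0.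
have := gr _ _ _ _ Aw; have := bd _ l; rewrite /=; lia.
Qed.

End ClosureRegularity.

(** * Transport of an extremal multidegree from [s] to [s * m] *)

Theorem theorem4p6 (K : fieldType) (n : nat) (I : {mpoly K[n]} -> Prop)
    (I_monomial : monomial_ideal I)
    (I_proper : ~ I 1)
    (I_nonzero : exists f : {mpoly K[n]}, I f /\ f <> 0)
    (s m : nat) (s_ge1 : (1 <= s)%N) (m_ge1 : (1 <= m)%N)
    (r r' : int)
    (reg_sm : is_reg (integral_closure (ideal_exp I (s * m))) r)
    (reg_s : is_reg (integral_closure (ideal_exp I s)) r') :
  r >= r' + (gamma I * s * (m - 1))%N%:Z.
Proof.
have [P [P_up IP]] := monomial_ideal_span I_monomial.
have P0 : ~ P 0%MM.
  move=> P0; apply: I_proper; apply/IP => u; rewrite mcoeff1.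
  by case: eqP => [->|_ /eqP]; rewrite ?eqxx.
have [w Pw] : exists w, P w.
  have [f [/IP Pf f0]] := I_nonzero; exists (mlead f); apply: Pf.
  by apply/eqP; rewrite mleadc_eq0; apply/eqP.
have gamI : is_gamma I (gamma I) by apply: (is_gamma_gamma IP) => //; exists w.
set g := gamma I in gamI *.
have g0 : (0 < g)%N by have [[u [j [_ uj ->]]] _] := gamI.
pose Q := mclosure (mpow P s); pose Q' := mclosure (mpow P (s * m)).
have mpow0 k : (0 < k)%N -> ~ mpow P k 0%MM.
  case: k => // k _ [a [b [Pa _ /eqP]]]; rewrite eq_sym mnmD_eq0 => /andP[/eqP a0 _].
  by apply: P0; rewrite -a0.
have r'_gt0 : 0 < r'.
  apply: (closure_reg_gt0 P_up IP reg_s).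
    exists (w *+ s)%MM, 1%N => //; exists (w *+ s)%MM, 0%MM.
    rewrite mulm1n addm0; split=> //; rewrite -[s in mpow _ s]mul1n.
    by apply: mpow_muln => //; exists w, 0%MM; rewrite addm0.
  move=> [l l0 /(mpow_mul _ _ _ P_up)]; have -> : (0 *+ l = 0 :> 'X_{1..n})%MM.
    by apply/mnmP => j; rewrite mulmnE mnm0E.
  by apply: mpow0; rewrite muln_gt0 s_ge1.
have Q_up : upset Q by apply/mclosure_up/mpow_up.
have Q'_up : upset Q' by apply/mclosure_up/mpow_up.
have [c sQ] := upset_stable Q_up; have [c' sQ'] := upset_stable Q'_up.
have [p hp] := closure_cohomology P_up IP reg_s.
(* Large enough for [normalized_multidegree], and for [t - 1] to exceed both stability
   thresholds. *)
pose t := (n * c + n + c + c' + 2)%N.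
have t0 : (0 < t)%N by rewrite /t; lia.
have [u [Hu Eu]] := hp t t0.
have ut : forall j, (t.-1 <= u j)%N.
  apply: (normalized_multidegree sQ _ _ _ Hu Eu); [by rewrite /t; lia|by lia|].
  by move=> v; apply: (closure_cohomology_le P_up IP reg_s).
have pn := has_cohomology_le Hu.
pose b := (\sum_j (u j - t))%N.
(* Equal faces carry the cohomology over to [u'], whose degree then bounds [r] from below with the
   same [p] and [t]. *)
suff [u' Hu' Du'] : exists2 u', forall F, faces Q t u F <-> faces Q' t u' F &
    (mdeg u + g * s * (m - 1) <= mdeg u')%N.
  have := closure_cohomology_le P_up IP reg_sm (has_cohomology_ext Hu' Hu); lia.
case: (leqP (g * s) b) => hb.
  (* An entry [t + x] becomes [t + m * x]; entries equal to [t - 1] stay, since the subtraction is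
     truncated. *)
  exists [multinom (u j + (u j - t) * (m - 1))%N | j < n]; last first.
    rewrite !mdegE; under [X in (_ <= X)%N]eq_bigr do rewrite mnmE.
    by rewrite big_split /= leq_add2l -big_distrl leq_mul2r hb orbT.
  move=> F; rewrite !facesE.
  set v := [multinom _ | _ < _]; set u' := [multinom _ | _ < _].
  have vE j : v j = (if j \in F then u j else u j - t)%N by rewrite mnmE.
  have u'E j : u' j = (u j + (u j - t) * (m - 1))%N by rewrite mnmE.
  set v' := [multinom _ | _ < _].
  have v'E j : v' j = (if j \in F then u' j else u' j - t)%N by rewrite mnmE.
  have tE : (forall j, j \notin F -> (t <= u j)%N) <-> forall j, j \notin F -> (t <= u' j)%N.
    split=> h j /h; rewrite u'E; first by move=> h1; apply: leq_trans (leq_addr _ _).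
    case: (leqP t (u j)) => // utj; have -> : (u j - t = 0)%N by lia.
    by rewrite mul0n addn0; lia.
  have Qv : Q v <-> Q' (v *+ m)%MM by apply: mclosure_scale.
  (* Off [F] the new exponents are exactly [m] times the old ones; on [F] both exceed the threshold
     [c'], so [mclosure_scale] applies up to stability. *)
  have cmp j : j \notin F -> (t <= u j)%N -> v' j = (v *+ m)%MM j.
    rewrite mulmnE v'E vE u'E => /negbTE -> tu; rewrite addnC -addnBA // addnC.
    by rewrite -{1}[(u j - t)%N]muln1 -mulnDr subnKC.
  have big j : j \in F -> (c' <= v' j)%N /\ (c' <= (v *+ m)%MM j)%N.
    rewrite mulmnE v'E vE u'E => ->; have := ut j; rewrite /t => utj; split; first by lia.
    by apply: leq_trans (leq_pmulr _ m_ge1); lia.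
  split=> -[h1 h2]; (split; first by apply/tE).
    apply: (sQ' (v *+ m)%MM); first exact/Qv.
    move=> j; case: (boolP (j \in F)) => jF; first by right; case: (big j jF).
    by left; rewrite cmp // h1.
  apply/Qv; apply: (sQ' v') => // j; case: (boolP (j \in F)) => jF.
    by right; case: (big j jF).
  by left; rewrite cmp //; apply: (proj2 tE h1).
(* If all entries were below [t], then [mdeg u + p] would be at most [n * t], against [0 < r']. *)
have [j0 uj0] : exists j, (t <= u j)%N.
  apply: NNPP => no; have : (mdeg u <= n * t.-1)%N.
    rewrite mdegE -[X in (_ <= X * _)%N](card_ord n) -sum_nat_const leq_sum // => j _.
    by rewrite -ltnS prednK // ltnNge; apply/negP => uj; apply: no; exists j.
  by move: Eu; case: (t) t0 => // t' _ /=; rewrite mulnS; lia.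
(* This raises the sum [b] to [g * s * m - 1], the largest value allowed by
   [faces_small_multidegree]; as [b <= g * s - 1], the gain is sufficient. *)
pose d := (g * (s * m) - 1 - b)%N.
have bd : (b + d = g * (s * m) - 1)%N.
  rewrite /d subnKC // -ltnS subn1 prednK ?muln_gt0 ?g0 ?s_ge1 //.
  by apply: leq_trans hb _; rewrite mulnA leq_pmulr.
exists (u + U_(j0) *+ d)%MM; last first.
  rewrite mdegD leq_add2l mdegMn mdeg1 mul1n mulnBr muln1 -mulnA.
  by rewrite /d leq_subRL; lia.
have u'E j : (u + U_(j0) *+ d)%MM j = (u j + (j0 == j) * d)%N.
  by rewrite mnmDE mulmnE mnm1E.
have ct : (c < t)%N by rewrite /t; lia.
have ct' : (c' < t)%N by rewrite /t; lia.
have uU'E j : (t <= u j)%N = (t <= (u + U_(j0) *+ d)%MM j)%N.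
  rewrite u'E; case: eqP => [<-|_]; last by rewrite addn0.
  by rewrite uj0 (leq_trans uj0) ?leq_addr.
have small : (\sum_j ((u + U_(j0) *+ d)%MM j - t) < g * (s * m))%N.
  have -> : (\sum_j ((u + U_(j0) *+ d)%MM j - t) = b + d)%N.
    rewrite /b (bigD1 j0) //= [in RHS](bigD1 j0) //= u'E eqxx mul1n.
    rewrite -addnBAC // addnAC; congr (_ + _ + _)%N; apply: eq_bigr => j /negbTE jj0.
    by rewrite u'E eq_sym jj0 addn0.
  by rewrite bd subn1 prednK // !muln_gt0 g0 s_ge1.
move=> F; rewrite (faces_small_multidegree P_up IP F gamI sQ ct ut hb).
rewrite (faces_small_multidegree P_up IP F gamI sQ' ct' _ small).
  by split=> -[h1 h2]; split=> // j /h1; rewrite uU'E.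
by move=> j; rewrite u'E; apply: leq_trans (leq_addr _ _).
Qed.
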